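(* Let $x,y,z\in\mathbb{C}^*$ with $|q|<|x|<1$, $|q|<|y|<1$ and $|q|<|z|<1$. Then $$\begin{aligned} \Big(\sum_{r,s,t\ge0}+\sum_{r,s,t<0}\Big)q^{rs+rt+st}x^ry^sz^t &=\frac{J_1^3j(yz;q)}{j(y;q)j(z;q)}\,m\Big(-\frac{qx}{yz},q^2,qyz\Big)+\frac{J_1^3j(xy;q)}{j(x;q)j(y;q)}\,m\Big(-\frac{qz}{xy},q^2,qxy\Big)\\ &\quad-2\,\frac{J_1^3J_2^3}{j(x;q)j(y;q)j(z;q)}\cdot\frac{j(xy;q^2)j(xz;q^2)j(yz;q^2)}{j(-x;q^2)j(-y;q^2)j(-z;q^2)}\\ &\quad+\frac{J_1^3j(xz;q)}{j(x;q)j(z;q)}\,m\Big(-\frac{qy}{xz},q^2,qxz\Big). \end{aligned}$$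
   Context: $q$ is a fixed complex number with $0<|q|<1$, $\mathbb{C}^*=\mathbb{C}\setminus\{0\}$. $(x;q)_\infty=\prod_{i\ge0}(1-q^ix)$, $j(x;q)=(x;q)_\infty(q/x;q)_\infty(q;q)_\infty=\sum_{n\in\mathbb{Z}}(-1)^nq^{\binom n2}x^n$, and $J_m=\prod_{i\ge1}(1-q^{mi})$ for positive integers $m$. The Appell–Lerch function is $$m(x,q,z)=\frac1{j(z;q)}\sum_{r=-\infty}^{\infty}\frac{(-1)^rq^{\binom r2}z^r}{1-q^{r-1}xz}.$$ Sums run over integers, and $\big(\sum_{r,s,t\ge0}+\sum_{r,s,t<0}\big)a_{r,s,t}$ means $\sum_{r,s,t\ge0}a_{r,s,t}+\sum_{r,s,t<0}a_{r,s,t}$.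
   Formalization: The conditions yz ≠ q, xy ≠ q and xz ≠ q are added: when one of them fails (e.g. q = 1/4, y = z = 1/2), the corresponding Appell–Lerch term, e.g. m(-qx/(yz), q^2, qyz), has the factor 1/j(q^2;q^2) = 1/0 and the right-hand side is undefined. *)

(* Defs.v *)
From HB Require Import structures.
From mathcomp Require Import all_boot all_order all_algebra finmap.
From mathcomp Require Import complex.
From mathcomp Require Import boolp classical_sets reals topology normedtype.
From mathcomp Require Import sequences.
From mathcomp Require Import summability.

Set Implicit Arguments.
Unset Strict Implicit.
Unset Printing Implicit Defensive.

Import Order.TTheory GRing.Theory Num.Theory.
Import numFieldNormedType.Exports.

Local Open Scope classical_set_scope.
Local Open Scope ring_scope.

(* The definitions are meant for K := R[i] with R : realType. The topology of
   a numFieldType is the one of its K-valued norm; on R[i] a radius e > 0 is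
   necessarily real, so this is the usual topology of the complex plane.

   Infinite sums are unconditional: limits of the finite partial sums along the
   filter `totally` of finite subsets of the index type ordered by inclusion
   (on the complex plane this is the same as absolute summation). *)

Definition restr_to (K : numFieldType) (I : choiceType) (D : pred I)
    (f : I -> K) (i : I) : K := if D i then f i else 0.

Definition sum_over (K : numFieldType) (I : choiceType) (D : pred I)
    (f : I -> K) : K := summability.sum (restr_to D f).

Definition summable_over (K : numFieldType) (I : choiceType) (D : pred I)
    (f : I -> K) : Prop :=
  cvg (partial_sum (restr_to D f) @ totally).

Definition nonneg3 : pred (int * int * int) :=
  fun i => [&& 0 <= i.1.1, 0 <= i.1.2 & 0 <= i.2].

Definition neg3 : pred (int * int * int) :=
  fun i => [&& i.1.1 < 0, i.1.2 < 0 & i.2 < 0].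

Definition qpoch (K : numFieldType) (x q : K) : K :=
  lim (\prod_(0 <= i < n) (1 - q ^+ i * x) @[n --> \oo]).

Definition jtheta (K : numFieldType) (x q : K) : K :=
  qpoch x q * qpoch (q / x) q * qpoch q q.

Definition Jprod (K : numFieldType) (q : K) (m : nat) : K :=
  lim (\prod_(1 <= i < n.+1) (1 - q ^+ (m * i)) @[n --> \oo]).

Definition binz2 (r : int) : int := ((r * (r - 1)) %/ 2)%Z.

(* The Appell-Lerch function m(x,q,z) is defined when neither z nor x z is an
   integral power of q; elsewhere the value below is an artefact of the
   convention 0^-1 = 0. *)
Definition appell_lerch (K : numFieldType) (x q z : K) : K :=
  (jtheta z q)^-1 *
  sum_over (fun _ : int => true)
    (fun r : int => (-1) ^ r * q ^ binz2 r * z ^ r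
                    / (1 - q ^ (r - 1) * x * z)).

(* Main.v *)
Require Import Defs.
From mathcomp Require Import all_boot all_order all_algebra finmap.
From mathcomp Require Import complex.
From mathcomp Require Import boolp classical_sets reals topology normedtype sequences.
From mathcomp Require Import summability.
From mathcomp Require Import zify ring lra.
Set Implicit Arguments.
Unset Strict Implicit.
Unset Printing Implicit Defensive.
Import Order.TTheory GRing.Theory Num.Theory.
Import numFieldNormedType.Exports.
Import Normc.
Local Open Scope classical_set_scope.
Local Open Scope ring_scope.
Local Open Scope complex_scope.

(** Fix [y] and [z].  Summing over [r] turns the triple sum into the Appell sum
    [sum_(s, t) +- q^(s t) y^s z^t / (1 - q^(s + t) x)], and all the terms of
    the identity become, after multiplication by [jtheta x q * jtheta (- x) (q^2)],
    sums of Laurent series in [x] that converge on the whole punctured plane.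
    The difference [H] of the two sides so multiplied ([defect]) satisfies
    [H (q^2 x) = H x / (y z x^2)]: it is a theta function of degree two.  As
    [|q|^2 < |y z| < 1], such a function is determined by its values at [1] and
    [-1], because its even and odd parts are multiples of theta functions of nome
    [q^4] that do not vanish at [1] ([degree2_eq0]); so it suffices to check
    [H 1 = H (-1) = 0].

    The functional equation of the triple sum ([tripleF_shift]) comes from the
    shift [(s, t) -> (s + 1, t + 1)]; its boundary terms are the Kronecker sums
    [sum_n y^n / (1 - q^n x)], which are quotients of theta functions
    ([kron_jtheta]).  The value at [-1] is immediate.  The value at [1] vanishes
    thanks to a relation between the Appell functions with exchanged arguments
    ([ell_symmetric_relation]).  Both this relation and [kron_jtheta] rest on the
    fact that theta functions of degree one form a line ([degree1]).

    The functional equations are used through uniqueness of Laurent coefficients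
    ([expands_unique]), obtained by averaging over the [2^k]-th roots of unity.
    The products defining [jtheta] are expanded by the Jacobi triple product,
    the limit ([triple_product], by dominated convergence) of a finite identity
    ([finite_triple_product]) stated for [jtheta x p / (1 - x)] rather than for
    [jtheta x p]: its value at [1] is then the cube of Euler's product, and the
    values at [1] of the Appell sums below reduce to that one ([kern_one]).  The
    coefficients of [jtheta x p / (1 - p^N x)] are bounded uniformly in [N]
    ([kern_coef_bound]), so that Appell sums times [jtheta] are Laurent series on
    the punctured plane. *)

(** * Bounded families of nonnegative reals *)

Section Majorants.
Variable R : realType.

(** A real family whose finite partial sums are bounded above; used as a
    majorant, hence always for nonnegative families. *)
Definition bounded_sums (I : choiceType) (g : I -> R) : Prop :=
  exists M : R, forall A : {fset I}, \sum_(i <- A) g i <= M.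

Lemma fset_sum_le_seq (I : choiceType) (g : I -> R) (A : {fset I}) (s : seq I) :
  (forall i, 0 <= g i) -> uniq s -> {subset A <= s} ->
  \sum_(i <- A) g i <= \sum_(i <- s) g i.
Proof.
move=> g0 us sub; rewrite [leRHS](bigID (mem A)) /=.
rewrite -[leLHS]addr0 lerD //; last exact: sumr_ge0.
rewrite le_eqVlt; apply/orP; left; apply/eqP; rewrite -[RHS]big_filter.
apply: perm_big; apply: uniq_perm => //; first exact: filter_uniq.
move=> i; rewrite mem_filter; apply/idP/andP => [iA|[]//].
by split=> //; apply: sub.
Qed.

Lemma fset_sum_subset (I : choiceType) (g : I -> R) (A B : {fset I}) :
  (forall i, 0 <= g i) -> (A `<=` B)%fset ->
  \sum_(i <- A) g i <= \sum_(i <- B) g i.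
Proof. by move=> g0 /fsubsetP sub; apply: fset_sum_le_seq. Qed.

Lemma bounded_sums_le (I : choiceType) (g h : I -> R) :
  (forall i, g i <= h i) -> bounded_sums h -> bounded_sums g.
Proof.
by move=> gh [M hM]; exists M => A; apply: le_trans (hM A); apply: ler_sum.
Qed.

Lemma bounded_sumsD (I : choiceType) (g h : I -> R) :
  bounded_sums g -> bounded_sums h -> bounded_sums (fun i => g i + h i).
Proof.
move=> [M gM] [N hN]; exists (M + N) => A; rewrite big_split.
exact: lerD.
Qed.

Lemma bounded_sumsZ (I : choiceType) (c : R) (g : I -> R) :
  0 <= c -> bounded_sums g -> bounded_sums (fun i => c * g i).
Proof.
move=> c0 [M gM]; exists (c * M) => A; rewrite -mulr_sumr.
exact: ler_wpM2l.
Qed.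

Lemma bounded_sums_inj (I J : choiceType) (h : J -> I) (g : I -> R) :
  injective h -> bounded_sums g -> bounded_sums (g \o h).
Proof.
move=> hI [M gM]; exists M => A; apply: le_trans (gM (h @` A)%fset).
by rewrite big_imfset //=; exact: in2W.
Qed.

Lemma bounded_sums_prod (I J : choiceType) (g : I -> R) (h : J -> R) :
  (forall i, 0 <= g i) -> (forall j, 0 <= h j) ->
  bounded_sums g -> bounded_sums h ->
  bounded_sums (fun p : I * J => g p.1 * h p.2).
Proof.
move=> g0 h0 [M gM] [N hN]; exists (M * N) => A.
pose s := [seq (i, j) | i <- [fset p.1 | p in A]%fset,
                        j <- [fset p.2 | p in A]%fset].
apply: (le_trans (@fset_sum_le_seq _ _ A s _ _ _)).
- by move=> p; apply: mulr_ge0.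
- by apply: allpairs_uniq => // -[a b] [c d].
- move=> p pA; apply/allpairsP; exists p.
  split; [exact/imfsetP/(ex_intro2 _ _ p)..|by case: p {pA}].
- rewrite big_allpairs /= -big_distrlr /= ler_pM ?sumr_ge0 //.
Qed.

Lemma bounded_sums_prod3 (I J L : choiceType) (g : I -> R) (h : J -> R)
    (k : L -> R) :
  (forall i, 0 <= g i) -> (forall j, 0 <= h j) -> (forall l, 0 <= k l) ->
  bounded_sums g -> bounded_sums h -> bounded_sums k ->
  bounded_sums (fun p : I * J * L => g p.1.1 * h p.1.2 * k p.2).
Proof.
move=> g0 h0 k0 gB hB kB.
apply: (@bounded_sums_prod _ _ (fun p => g p.1 * h p.2) k) => //.
  by move=> p; apply: mulr_ge0.
exact: bounded_sums_prod.
Qed.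

Lemma bounded_sums_nat (g : nat -> R) (M : R) :
  (forall i, 0 <= g i) -> (forall n, \sum_(i < n) g i <= M) -> bounded_sums g.
Proof.
move=> g0 gM; exists M => A.
apply: le_trans (gM (\max_(i <- A) i).+1); rewrite -(big_mkord predT).
apply: fset_sum_le_seq => //; first exact: iota_uniq.
by move=> i iA; rewrite mem_index_iota ltnS leq_bigmax_seq.
Qed.

Lemma bounded_sums_geom (r : R) : 0 <= r < 1 ->
  bounded_sums (fun n : nat => r ^+ n).
Proof.
move=> /andP[r0 r1]; apply: (@bounded_sums_nat _ (1 - r)^-1).
  by move=> i; exact: exprn_ge0.
move=> n; rewrite -[leRHS]mul1r ler_pdivlMr ?subr_gt0 //.
by rewrite -[1 - r]opprB mulrN mulrC -subrX1 opprB lerBlDr lerDl exprn_ge0.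
Qed.

Lemma bounded_sums_int (g : int -> R) : (forall i, 0 <= g i) ->
  bounded_sums (fun n : nat => g n) -> bounded_sums (fun n : nat => g (Negz n)) ->
  bounded_sums g.
Proof.
move=> g0 [M gM] [N gN]; exists (M + N) => A.
pose B := [fset absz i | i in A]%fset; pose C := [fset (absz i).-1 | i in A]%fset.
pose s := [seq Posz n | n <- B] ++ [seq Negz n | n <- C].
apply: (le_trans (@fset_sum_le_seq _ _ A s _ _ _)) => //.
- rewrite cat_uniq !map_inj_uniq //; try by move=> ? ? [].
  by rewrite !fset_uniq andbT /=; apply/hasPn => _ /mapP[i _ ->]; apply/mapP => -[].
- move=> i iA; rewrite mem_cat; apply/orP; case: i iA => n nA; [left|right].
  + by apply/mapP; exists n => //; apply/imfsetP; exists (Posz n).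
  + by apply/mapP; exists n => //; apply/imfsetP; exists (Negz n).
- by rewrite big_cat !big_map lerD.
Qed.

End Majorants.

(** * Absolutely summable families of complex numbers *)

#[local] Existing Instance totally_filter.

Lemma partial_sum_cvg (K : numFieldType) (I : choiceType) (f : I -> K) (l : K) :
  (forall e, 0 < e -> exists A : {fset I}, forall B : {fset I},
    (A `<=` B)%fset -> `|l - \sum_(i <- B) f i| < e) ->
  partial_sum f @ totally --> l.
Proof.
move=> fl; apply/cvgrPdist_lt => e /fl[A hA]; exists A => // B /= AB.
by have := hA _ AB; rewrite big_seq_fsetE.
Qed.

Lemma partial_sum_lim (K : numFieldType) (I : choiceType) (f : I -> K) (l : K) :
  (forall e, 0 < e -> exists A : {fset I}, forall B : {fset I},
    (A `<=` B)%fset -> `|l - \sum_(i <- B) f i| < e) ->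
  sum_over (fun=> true) f = l.
Proof.
move=> /partial_sum_cvg fl; rewrite /sum_over /summability.sum.
have -> : restr_to xpredT f = f by apply: funext.
by apply: cvg_lim => //; exact: norm_hausdorff.
Qed.

Section ComplexSums.
Variable R : realType.
Notation C := R[i].
Notation Re := complex.Re.
Notation Im := complex.Im.

Lemma normc_ge0 (z : C) : 0 <= normc z.
Proof. by case: z => a b; apply: sqrtr_ge0. Qed.

Lemma normcR (a : R) : normc a%:C = `|a|.
Proof. by rewrite /normc /= expr0n /= addr0 sqrtr_sqr. Qed.

Lemma normcE (z : C) : `|z| = (normc z)%:C.
Proof. by []. Qed.

Lemma normc_sum (I : Type) (s : seq I) (P : pred I) (f : I -> C) :
  normc (\sum_(i <- s | P i) f i) <= \sum_(i <- s | P i) normc (f i).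
Proof.
elim/big_ind2: _ => [|x1 x2 y1 y2 h1 h2|//]; first by rewrite normc0.
by apply: le_trans (le_normcD _ _) _; apply: lerD.
Qed.

Lemma normcB (x y : C) : normc (x - y) = normc (y - x).
Proof. by rewrite -opprB normcN. Qed.

Lemma normcX (x : C) n : normc (x ^+ n) = normc x ^+ n.
Proof.
by elim: n => [|n IH]; rewrite ?expr0 ?normc1 // !exprS normcM IH.
Qed.

Lemma normcXz (x : C) (n : int) : normc (x ^ n) = normc x ^ n.
Proof.
case: n => n; first exact: normcX.
by rewrite -[x ^ Negz n]/((x ^+ n.+1)^-1) normcV normcX.
Qed.

Lemma normc_eq0 (x : C) : (normc x == 0) = (x == 0).
Proof. by apply/eqP/eqP => [/eq0_normc //|->]; rewrite normc0. Qed.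

Lemma normc_gt0 (x : C) : (0 < normc x) = (x != 0).
Proof. by rewrite lt_def normc_eq0 normc_ge0 andbT. Qed.

Lemma Re_le_normc (z : C) : `|Re z| <= normc z.
Proof.
case: z => a b /=; rewrite -sqrtr_sqr; apply: ler_wsqrtr.
by rewrite lerDl sqr_ge0.
Qed.

Lemma Im_le_normc (z : C) : `|Im z| <= normc z.
Proof.
case: z => a b /=; rewrite -sqrtr_sqr; apply: ler_wsqrtr.
by rewrite lerDr sqr_ge0.
Qed.

(** [has_sum f l]: the partial sums over finite sets of indices converge to [l]
    along the inclusion order. *)
Definition has_sum (I : choiceType) (f : I -> C) (l : C) : Prop :=
  forall e : R, 0 < e -> exists A : {fset I}, forall B : {fset I},
    (A `<=` B)%fset -> normc (l - \sum_(i <- B) f i) < e.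

(** Over the complex numbers, absolute and unconditional summability agree; the
    absolute form is the one that is checked by comparison with a majorant. *)
Definition abs_summable (I : choiceType) (f : I -> C) : Prop :=
  bounded_sums (fun i => normc (f i)).

(** The unconditional sum over the whole index type. *)
Definition tsum (I : choiceType) (f : I -> C) : C := sum_over (fun=> true) f.

Lemma sum_overE (I : choiceType) (D : pred I) (f : I -> C) :
  sum_over D f = tsum (restr_to D f).
Proof. by rewrite /tsum /sum_over; congr summability.sum; apply: funext. Qed.

Lemma has_sum_norm (I : choiceType) (f : I -> C) l : has_sum f l ->
  forall e : C, 0 < e -> exists A : {fset I}, forall B : {fset I},
    (A `<=` B)%fset -> `|l - \sum_(i <- B) f i| < e.
Proof.
move=> fl e e0; have [r re] : exists r : R, e = r%:C.
  by apply/complex_realP; rewrite realE ltW.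
have r0 : 0 < r by move: e0; rewrite re ltcR.
by have [A hA] := fl _ r0; exists A => B /hA; rewrite re normcE ltcR.
Qed.

Lemma has_sum_summable (I : choiceType) (D : pred I) (f : I -> C) l :
  has_sum (restr_to D f) l -> summable_over D f.
Proof. by move=> /has_sum_norm/partial_sum_cvg h; apply/cvg_ex; exists l. Qed.

Lemma has_sum_tsum (I : choiceType) (f : I -> C) l : has_sum f l -> tsum f = l.
Proof. by move=> /has_sum_norm; apply: partial_sum_lim. Qed.

Lemma has_sumD (I : choiceType) (f g : I -> C) l m :
  has_sum f l -> has_sum g m -> has_sum (fun i => f i + g i) (l + m).
Proof.
move=> fl gm e e0; have e2 : 0 < e / 2 by rewrite divr_gt0.
have [A hA] := fl _ e2; have [B hB] := gm _ e2.
exists (A `|` B)%fset => D; rewrite fsubUset => /andP[AD BD].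
rewrite big_split /= opprD addrACA (splitr e).
by apply: le_lt_trans (le_normcD _ _) _; rewrite ltrD ?hA ?hB.
Qed.

Lemma has_sumZ (I : choiceType) (c : C) (f : I -> C) l :
  has_sum f l -> has_sum (fun i => c * f i) (c * l).
Proof.
move=> fl e e0; have c0 : 0 < normc c + 1 by rewrite ltr_wpDl ?normc_ge0.
have [|A hA] := fl (e / (normc c + 1)); first by rewrite divr_gt0.
exists A => B /hA hB; rewrite -mulr_sumr -mulrBr normcM.
rewrite -[e](divfK (lt0r_neq0 c0)) mulrC.
apply: (@le_lt_trans _ _ (normc (l - \sum_(i <- B) f i) * (normc c + 1))).
  by rewrite ler_wpM2l ?normc_ge0 // lerDl.
by rewrite ltr_pM2r.
Qed.

Lemma has_sum_real (I : choiceType) (g : I -> R) :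
  (forall i, 0 <= g i) -> bounded_sums g ->
  exists s : R, has_sum (fun i => (g i)%:C) s%:C.
Proof.
move=> g0 [M gM]; pose E := [set r : R | exists A : {fset I}, r = \sum_(i <- A) g i].
have ubE : has_ubound E by exists M => _ [A ->].
have supE : has_sup E by split=> //; exists 0, fset0; rewrite big_seq_fset0.
exists (sup E) => e e0; have [_ [A ->] hA] := sup_adherent e0 supE.
exists A => B AB; rewrite -rmorph_sum -rmorphB normcR ger0_norm; last first.
  by rewrite subr_ge0; apply: ub_le_sup => //; exists B.
rewrite ltrBlDr addrC -ltrBlDr; apply: lt_le_trans hA _.
exact: fset_sum_subset.
Qed.

Lemma abs_summable_le (I : choiceType) (f : I -> C) (g : I -> R) :
  (forall i, normc (f i) <= g i) -> bounded_sums g -> abs_summable f.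
Proof. exact: bounded_sums_le. Qed.

Lemma abs_summableD (I : choiceType) (f g : I -> C) :
  abs_summable f -> abs_summable g -> abs_summable (fun i => f i + g i).
Proof.
move=> fs gs; apply: abs_summable_le (bounded_sumsD fs gs) => i.
exact: le_normcD.
Qed.

Lemma abs_summableZ (I : choiceType) (c : C) (f : I -> C) :
  abs_summable f -> abs_summable (fun i => c * f i).
Proof.
move=> fs; apply: abs_summable_le (bounded_sumsZ (normc_ge0 c) fs) => i.
by rewrite normcM.
Qed.

Lemma abs_summableN (I : choiceType) (f : I -> C) :
  abs_summable f -> abs_summable (fun i => - f i).
Proof. by apply: abs_summable_le => i; rewrite normcN. Qed.

Lemma abs_summable_inj (I J : choiceType) (h : J -> I) (f : I -> C) :
  injective h -> abs_summable f -> abs_summable (f \o h).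
Proof. exact: bounded_sums_inj. Qed.

Lemma abs_summable_prod (I J : choiceType) (f : I -> C) (g : J -> C) :
  abs_summable f -> abs_summable g ->
  abs_summable (fun p : I * J => f p.1 * g p.2).
Proof.
move=> fs gs; apply: (abs_summable_le _ (bounded_sums_prod _ _ fs gs)).
- by move=> p; rewrite normcM.
- by move=> i; apply: normc_ge0.
- by move=> i; apply: normc_ge0.
Qed.

(** The real and imaginary parts, once [|f i|] is added to them, become
    nonnegative families with bounded partial sums. *)
Lemma abs_has_sum (I : choiceType) (f : I -> C) :
  abs_summable f -> has_sum f (tsum f).
Proof.
move=> fs; pose a i := normc (f i).
have bnd (u : C -> R) : (forall z, `|u z| <= normc z) ->
    exists s, has_sum (fun i => (a i + u (f i))%:C) s%:C.
  move=> hu; apply: has_sum_real.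
    by move=> i; rewrite -lerBlDl sub0r lerNl; case/ler_normlP: (hu (f i)).
  apply: bounded_sums_le (bounded_sumsD fs fs) => i.
  by rewrite lerD2l; apply: le_trans (ler_norm _) (hu _).
have [s hs] := bnd _ Re_le_normc; have [t ht] := bnd _ Im_le_normc.
have [m hm] : exists m, has_sum (fun i => (a i)%:C) m%:C.
  by apply: has_sum_real => // i; apply: normc_ge0.
have h := has_sumD (has_sumD hs (has_sumZ 'i%C ht)) (has_sumZ (- (1 + 'i%C)) hm).
set l := (X in has_sum _ X) in h; have fl : has_sum f l.
  move: h; set g := (X in has_sum X _); suff -> : g = f by [].
  apply: funext => i; rewrite /g !rmorphD /= [in RHS](complexE (f i)); ring.
by rewrite (has_sum_tsum fl).
Qed.

Lemma abs_summable_cvg (I : choiceType) (D : pred I) (f : I -> C) :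
  abs_summable (restr_to D f) -> summable_over D f.
Proof. by move=> /abs_has_sum/has_sum_summable. Qed.

Lemma has_sum_ext (I : choiceType) (f g : I -> C) l :
  f =1 g -> has_sum f l -> has_sum g l.
Proof. by move=> /funext ->. Qed.

Lemma eq_tsum (I : choiceType) (f g : I -> C) : f =1 g -> tsum f = tsum g.
Proof. by move=> /funext ->. Qed.

Lemma eq_abs_summable (I : choiceType) (f g : I -> C) :
  f =1 g -> abs_summable f -> abs_summable g.
Proof. by move=> /funext ->. Qed.

Lemma tsumD (I : choiceType) (f g : I -> C) :
  abs_summable f -> abs_summable g ->
  tsum (fun i => f i + g i) = tsum f + tsum g.
Proof.
by move=> /abs_has_sum fs /abs_has_sum gs; apply/has_sum_tsum/has_sumD.
Qed.

Lemma tsumZ (I : choiceType) (c : C) (f : I -> C) :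
  abs_summable f -> tsum (fun i => c * f i) = c * tsum f.
Proof. by move=> /abs_has_sum fs; apply/has_sum_tsum/has_sumZ. Qed.

Lemma tsumN (I : choiceType) (f : I -> C) :
  abs_summable f -> tsum (fun i => - f i) = - tsum f.
Proof.
move=> fs; rewrite -mulN1r -tsumZ //; apply: eq_tsum => i; exact/esym/mulN1r.
Qed.

Lemma tsumB (I : choiceType) (f g : I -> C) :
  abs_summable f -> abs_summable g ->
  tsum (fun i => f i - g i) = tsum f - tsum g.
Proof. by move=> fs gs; rewrite tsumD ?tsumN //; apply: abs_summableN. Qed.

Lemma has_sum_finite (I : choiceType) (f : I -> C) (A : {fset I}) :
  (forall i, i \notin A -> f i = 0) -> has_sum f (\sum_(i <- A) f i).
Proof.
move=> f0 e e0; exists A => B AB.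
by rewrite (big_fset_incl _ AB) ?subrr ?normc0 // => i _; apply: f0.
Qed.

Lemma tsum_single (I : choiceType) (f : I -> C) (i0 : I) :
  (forall i, i != i0 -> f i = 0) -> tsum f = f i0.
Proof.
move=> f0; apply: has_sum_tsum; have <- : \sum_(i <- [fset i0]%fset) f i = f i0 by rewrite big_seq_fset1.
by apply: has_sum_finite => i; rewrite inE; apply: f0.
Qed.

Lemma tsum0 (I : choiceType) : tsum (fun _ : I => 0) = 0.
Proof.
by apply: has_sum_tsum => e e0; exists fset0 => B _; rewrite big1_eq subrr normc0.
Qed.

Lemma fset_sum_image (V : nmodType) (I J : choiceType) (h : J -> I) (f : I -> V)
    (A : {fset J}) :
  injective h -> \sum_(i <- (h @` A)%fset) f i = \sum_(j <- A) f (h j).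
Proof. by move=> hI; rewrite big_imfset //=; exact: in2W. Qed.

Lemma fset_preimage (I J : choiceType) (h : J -> I) (B : {fset I}) :
  injective h -> exists E : {fset J}, forall j, (j \in E) = (h j \in B).
Proof.
move=> hI; pose inv i : option J :=
  if pselect (exists j, i == h j) is left P then Some (xchoose P) else None.
have invK j : inv (h j) = Some j.
  rewrite /inv; case: pselect => [P|[]]; last by exists j.
  by congr Some; apply: hI; rewrite -(eqP (xchooseP P)).
exists [fset j in pmap inv (enum_fset B)]%fset => j.
rewrite !inE /= mem_pmap; apply/mapP/idP => [[i iB]|hB].
  by rewrite /inv; case: pselect => // P [->]; rewrite -(eqP (xchooseP P)).
by exists (h j); rewrite ?invK.
Qed.

Lemma fset_sum_preimage (V : nmodType) (I J : choiceType) (h : J -> I) (f : I -> V)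
    (B : {fset I}) (E : {fset J}) :
  injective h -> (forall i, (forall j, i != h j) -> f i = 0) ->
  (forall j, (j \in E) = (h j \in B)) ->
  \sum_(i <- B) f i = \sum_(j <- E) f (h j).
Proof.
move=> hI f0 EE; rewrite -(fset_sum_image f E hI); apply/esym/big_fset_incl.
  by apply/fsubsetP => i /imfsetP[j]; rewrite /= EE => hj ->.
move=> i iB iE; apply: f0 => j; apply: contraNneq iE => ij.
by apply/imfsetP; exists j => //=; rewrite EE -ij.
Qed.

(** Extending a family by zero along an injection does not change its sum; for
    a bijection this is reindexing. *)
Lemma has_sum_inj (I J : choiceType) (h : J -> I) (f : I -> C) l :
  injective h -> (forall i, (forall j, i != h j) -> f i = 0) ->
  has_sum (f \o h) l <-> has_sum f l.
Proof.
move=> hI f0; split=> fl e e0; have [A hA] := fl _ e0.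
- exists (h @` A)%fset => B AB; have [E EE] := fset_preimage B hI.
  rewrite (fset_sum_preimage hI f0 EE); apply: hA.
  by apply/fsubsetP => j jA; rewrite EE; apply: (fsubsetP AB); apply: in_imfset.
- have [E EE] := fset_preimage A hI; exists E => B EB.
  rewrite -[X in _ - X](fset_sum_image f B hI).
  have := hA (A `|` (h @` B))%fset (fsubsetUl _ _).
  rewrite -(@big_fset_incl _ _ _ _ (h @` B)%fset) ?fsubsetUr // => i.
  rewrite in_fsetU => /orP[iA iB|-> //]; apply: f0 => j; apply: contraNneq iB => ij.
  by rewrite ij in_imfset //=; apply: (fsubsetP EB); rewrite EE -ij.
Qed.

Lemma abs_summable_ext (I J : choiceType) (h : J -> I) (f : I -> C) :
  injective h -> (forall i, (forall j, i != h j) -> f i = 0) ->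
  abs_summable (f \o h) -> abs_summable f.
Proof.
move=> hI f0 [M hM]; exists M => B; have [E EE] := fset_preimage B hI.
rewrite (fset_sum_preimage hI _ EE) // => i /f0 ->; exact: normc0.
Qed.

Lemma abs_summable_finite (I : choiceType) (f : I -> C) (A : {fset I}) :
  (forall i, i \notin A -> f i = 0) -> abs_summable f.
Proof.
move=> f0; exists (\sum_(i <- A) normc (f i)) => B.
apply: (@le_trans _ _ (\sum_(i <- (A `|` B)%fset) normc (f i))).
  by apply: fset_sum_subset (fsubsetUr _ _) => i; apply: normc_ge0.
rewrite le_eqVlt; apply/orP; left; apply/eqP/esym/big_fset_incl.
  exact: fsubsetUl.
by move=> i _ /f0 ->; rewrite normc0.
Qed.

Lemma tsum_nat_finite (f : nat -> C) n : (forall m, (n <= m)%N -> f m = 0) ->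
  tsum f = \sum_(m < n) f m.
Proof.
move=> f0; rewrite -(big_mkord predT); apply: has_sum_tsum.
have <- : \sum_(k <- [fset k in index_iota 0 n]%fset) f k = \sum_(0 <= k < n) f k.
  by apply/perm_big/uniq_perm; rewrite ?fset_uniq ?iota_uniq // => k; rewrite !inE.
by apply: has_sum_finite => i; rewrite !inE mem_index_iota -leqNgt; apply: f0.
Qed.

Lemma tsum_bij (I J : choiceType) (h : J -> I) (f : I -> C) :
  bijective h -> abs_summable f -> tsum f = tsum (fun j => f (h j)).
Proof.
move=> hB /abs_has_sum fs; apply/esym/has_sum_tsum.
apply: (proj2 (@has_sum_inj _ _ h f _ (bij_inj hB) _)) fs => i.
by case: hB => g _ hK /(_ (g i)); rewrite hK eqxx.
Qed.

Lemma normc_tsum (I : choiceType) (f : I -> C) (M : R) :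
  abs_summable f -> (forall A : {fset I}, \sum_(i <- A) normc (f i) <= M) ->
  normc (tsum f) <= M.
Proof.
move=> /abs_has_sum fs hM; apply/ler_addgt0Pr => e e0.
have [A /(_ A (fsubset_refl _)) hA] := fs _ e0.
rewrite -[tsum f](subrK (\sum_(i <- A) f i)) addrC.
apply: le_trans (le_normcD _ _) _; apply: lerD; last exact: ltW.
exact: le_trans (normc_sum _ _ _) _.
Qed.

Lemma common_fset (I J : choiceType) (f : I -> J -> C) (l : I -> C) (s : seq I)
    (e : R) : 0 < e -> (forall i, has_sum (f i) (l i)) ->
  exists A : {fset J}, forall B : {fset J}, (A `<=` B)%fset ->
    forall i, i \in s -> normc (l i - \sum_(j <- B) f i j) < e.
Proof.
move=> e0 fl; elim: s => [|a s [A hA]]; first by exists fset0.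
have [D hD] := fl a _ e0; exists (A `|` D)%fset => B.
rewrite fsubUset => /andP[AB DB] i; rewrite inE => /predU1P[->|]; first exact: hD.
exact: hA.
Qed.

Lemma fset_sum_pair (V : nmodType) (I J : choiceType) (f : I * J -> V)
    (A : {fset I}) (B : {fset J}) :
  \sum_(p <- (A `*` B)%fset) f p = \sum_(i <- A) \sum_(j <- B) f (i, j).
Proof.
transitivity (\sum_(p <- [seq (i, j) | i <- A, j <- B]) f p); last first.
  by rewrite big_allpairs.
apply/perm_big/uniq_perm; first exact: fset_uniq.
  by apply: allpairs_uniq; rewrite ?fset_uniq // => -[a b] [c d].
move=> [i j]; rewrite in_fsetM; apply/idP/allpairsP => [/andP[iA jB]|].
  by exists (i, j).
by move=> [[a b] /= [aA bB [-> ->]]]; rewrite aA.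
Qed.

Lemma abs_summable_row (I J : choiceType) (f : I * J -> C) i :
  abs_summable f -> abs_summable (fun j => f (i, j)).
Proof. by apply: (@abs_summable_inj _ _ (pair i)) => a b []. Qed.

Lemma abs_summable_tsum (I J : choiceType) (f : I * J -> C) :
  abs_summable f -> abs_summable (fun i => tsum (fun j => f (i, j))).
Proof.
move=> fs; have [M hM] := fs; exists M => A; apply/ler_addgt0Pr => e e0.
pose d := e / (size A).+1%:R; have d0 : 0 < d by rewrite divr_gt0.
have [B /(_ B (fsubset_refl _)) hB] := @common_fset I J (fun i j => f (i, j)) _
  A d d0 (fun i => abs_has_sum (abs_summable_row i fs)).
apply: (@le_trans _ _ (\sum_(i <- A) (\sum_(j <- B) normc (f (i, j)) + d))).
  rewrite big_seq [leRHS]big_seq; apply: ler_sum => i /hB hi.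
  set t := tsum _; rewrite -[t](subrK (\sum_(j <- B) f (i, j))) addrC.
  apply: le_trans (le_normcD _ _) _; apply: lerD; last exact: ltW.
  exact: normc_sum.
rewrite big_split /=; apply: lerD.
  by rewrite -(fset_sum_pair (fun p => normc (f p))).
rewrite big_const_seq count_predT iter_addr_0 /d -[e / _ *+ _]mulr_natr.
by rewrite mulrAC ler_pdivrMr ?ltr0n // ler_pM2l // ler_nat.
Qed.

(** Fubini for absolutely summable double families. *)
Lemma tsum_pair (I J : choiceType) (f : I * J -> C) :
  abs_summable f -> tsum f = tsum (fun i => tsum (fun j => f (i, j))).
Proof.
move=> fs; apply/esym/has_sum_tsum => e e0.
have e2 : 0 < e / 2 by rewrite divr_gt0.
have [A hA] := abs_has_sum fs e2.
exists [fset p.1 | p in A]%fset => B AB.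
pose d := e / 2 / (size B).+1%:R; have d0 : 0 < d by rewrite divr_gt0.
have [D hD] := @common_fset I J (fun i j => f (i, j)) _
  B d d0 (fun i => abs_has_sum (abs_summable_row i fs)).
pose E := (D `|` [fset p.2 | p in A])%fset.
have {}hD := hD E (fsubsetUl _ _).
have {}hA : normc (tsum f - \sum_(p <- (B `*` E)%fset) f p) < e / 2.
  apply: hA; apply/fsubsetP => p pA; rewrite in_fsetM; apply/andP; split.
    by apply: (fsubsetP AB); apply/imfsetP; exists p.
  by rewrite in_fsetU; apply/orP; right; apply/imfsetP; exists p.
rewrite (splitr e) -(subrKA (\sum_(p <- (B `*` E)%fset) f p)).
apply: le_lt_trans (le_normcD _ _) _; apply: ltr_leD => //.
rewrite fset_sum_pair -sumrB; apply: le_trans (normc_sum _ _ _) _.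
apply: (@le_trans _ _ (\sum_(i <- B) d)).
  by rewrite big_seq [leRHS]big_seq; apply: ler_sum => i /hD; rewrite normcB => /ltW.
rewrite big_const_seq count_predT iter_addr_0 /d -[_ / _ *+ _]mulr_natr.
by rewrite mulrAC ler_pdivrMr ?ltr0n // ler_pM2l // ler_nat.
Qed.

Lemma tsum_prod (I J : choiceType) (f : I -> C) (g : J -> C) :
  abs_summable f -> abs_summable g ->
  tsum (fun p : I * J => f p.1 * g p.2) = tsum f * tsum g.
Proof.
move=> fs gs; rewrite tsum_pair /=; last exact: abs_summable_prod.
rewrite mulrC -tsumZ //; apply: eq_tsum => i; rewrite tsumZ // mulrC //.
Qed.

End ComplexSums.

(** * Sequences and dominated convergence *)

(** The limit operator in terms of which [qpoch] and [Jprod] are defined. *)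
Definition seq_limit (K : numFieldType) (u : nat -> K) : K :=
  lim (u n @[n --> \oo]).

Lemma seq_lim_eq (K : numFieldType) (u : nat -> K) (l : K) :
  (forall e, 0 < e -> exists N, forall n, (N <= n)%N -> `|l - u n| < e) ->
  seq_limit u = l.
Proof.
move=> ul; apply: cvg_lim; first exact: norm_hausdorff.
apply/cvgrPdist_lt => e /ul[N hN]; near=> n; apply: hN; near: n.
exact: nbhs_infty_ge.
Unshelve. all: by end_near. Qed.

Section Limits.
Variable R : realType.
Notation C := R[i].
Implicit Types (u v : nat -> C) (l : C).

(** Convergence of complex sequences, with real-valued moduli. *)
Definition seq_cvg u l : Prop := forall e : R, 0 < e ->
  exists N, forall n, (N <= n)%N -> normc (l - u n) < e.

Lemma seq_cvg_lim u l : seq_cvg u l -> seq_limit u = l.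
Proof.
move=> ul; apply: seq_lim_eq => e e0; have [r re] : exists r : R, e = r%:C.
  by apply/complex_realP; rewrite realE ltW.
have r0 : 0 < r by move: e0; rewrite re ltcR.
by have [N hN] := ul _ r0; exists N => n /hN; rewrite re normcE ltcR.
Qed.

Lemma seq_cvg_unique u l m : seq_cvg u l -> seq_cvg u m -> l = m.
Proof. by move=> /seq_cvg_lim <- /seq_cvg_lim. Qed.

Lemma eq_seq_cvg u v l : u =1 v -> seq_cvg u l -> seq_cvg v l.
Proof. by move=> /funext ->. Qed.

Lemma seq_cvg_cst l : seq_cvg (fun=> l) l.
Proof. by move=> e e0; exists 0%N => n _; rewrite subrr normc0. Qed.

Lemma seq_cvg_sub (s : nat -> nat) u l :
  (forall n, (n <= s n)%N) -> seq_cvg u l -> seq_cvg (u \o s) l.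
Proof.
move=> hs ul e /ul[N hN]; exists N => n Nn; apply: hN.
exact: leq_trans (hs n).
Qed.

Lemma seq_cvgD u v l m :
  seq_cvg u l -> seq_cvg v m -> seq_cvg (fun n => u n + v n) (l + m).
Proof.
move=> ul vm e e0; have e2 : 0 < e / 2 by rewrite divr_gt0.
have [M hM] := ul _ e2; have [N hN] := vm _ e2; exists (maxn M N) => n.
rewrite geq_max => /andP[/hM h1 /hN h2]; rewrite opprD addrACA (splitr e).
by apply: le_lt_trans (le_normcD _ _) _; rewrite ltrD.
Qed.

Lemma finite_bound u N : exists2 M, 0 <= M &
  forall n, (n < N)%N -> normc (u n) <= M.
Proof.
have u0 n : 0 <= normc (u n) by apply: normc_ge0.
exists (\sum_(k < N) normc (u k)) => [|n nN]; first exact: sumr_ge0.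
by rewrite (bigD1 (Ordinal nN)) //= lerDl sumr_ge0.
Qed.

Lemma seq_cvg_bounded u l : seq_cvg u l ->
  exists2 M, 0 < M & forall n, normc (u n) <= M.
Proof.
move=> ul; have [N hN] := ul 1 ltr01; have [M M0 hM] := finite_bound u N.
exists (M + (normc l + 1)) => [|n].
  by rewrite ltr_wpDl // ltr_wpDl ?normc_ge0.
case: (ltnP n N) => [/hM h|/hN h].
  by apply: le_trans h _; rewrite lerDl addr_ge0 ?normc_ge0.
rewrite -[u n](subrK l) addrC; apply: le_trans (le_normcD _ _) _.
by rewrite addrCA lerD2l normcB ler_wpDl // ltW.
Qed.

Lemma seq_cvgM u v l m :
  seq_cvg u l -> seq_cvg v m -> seq_cvg (fun n => u n * v n) (l * m).
Proof.
move=> ul vm e e0; have [B B0 hB] := seq_cvg_bounded ul.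
have m0 : 0 < normc m + 1 by rewrite ltr_wpDl ?normc_ge0.
have e1 : 0 < e / 2 / (normc m + 1) by rewrite !divr_gt0.
have e2 : 0 < e / 2 / B by rewrite !divr_gt0.
have [M hM] := ul _ e1; have [N hN] := vm _ e2; exists (maxn M N) => n.
rewrite geq_max => /andP[/hM h1 /hN h2].
have -> : l * m - u n * v n = (l - u n) * m + u n * (m - v n) by ring.
apply: le_lt_trans (le_normcD _ _) _; rewrite (splitr e) !normcM.
apply: ltr_leD.
  apply: (@le_lt_trans _ _ (normc (l - u n) * (normc m + 1))).
    by rewrite ler_wpM2l ?normc_ge0 // lerDl.
  by rewrite -ltr_pdivlMr.
apply: (@le_trans _ _ (B * (e / 2 / B))); last by rewrite mulrC divfK ?gt_eqF.
by apply: ler_pM; rewrite ?normc_ge0 // ltW.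
Qed.

Lemma seq_cvgV u l : l != 0 -> seq_cvg u l -> seq_cvg (fun n => (u n)^-1) l^-1.
Proof.
move=> l0 ul e e0; have nl : 0 < normc l by rewrite normc_gt0.
have l2 : 0 < normc l / 2 by rewrite divr_gt0.
have e1 : 0 < e * (normc l * (normc l / 2)) by rewrite (mulr_gt0 e0) // mulr_gt0.
have [M hM] := ul _ l2; have [N hN] := ul _ e1; exists (maxn M N) => n.
rewrite geq_max => /andP[/hM h1 /hN h2].
have un : normc l / 2 < normc (u n).
  rewrite -(ltrD2r (normc l / 2)) -splitr.
  rewrite -{1}(subrK (u n) l); apply: le_lt_trans (le_normcD _ _) _.
  by rewrite addrC ltrD2l.
have u0 : u n != 0 by rewrite -normc_gt0 (lt_trans l2).
have -> : l^-1 - (u n)^-1 = - (l - u n) / (l * u n) by field; rewrite u0.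
rewrite normcM normcN normcV normcM ltr_pdivrMr ?mulr_gt0 ?normc_gt0 //.
apply: lt_trans h2 _; rewrite ltr_pM2l // ltr_pM2l //.
Qed.

Lemma seq_cvg_const_bound u l (d : R) :
  (forall n, d <= normc (u n)) -> seq_cvg u l -> d <= normc l.
Proof.
move=> hd ul; apply/ler_addgt0Pr => e /ul[N /(_ N (leqnn N)) h].
apply: le_trans (hd N) _; rewrite -[u N](subrK l) addrC.
by apply: le_trans (le_normcD _ _) _; rewrite lerD2l normcB ltW.
Qed.

Lemma seq_cvg_upper_bound u l (d : R) :
  (forall n, normc (u n) <= d) -> seq_cvg u l -> normc l <= d.
Proof.
move=> hd ul; apply/ler_addgt0Pr => e /ul[N /(_ N (leqnn N)) h].
rewrite -[l](subrK (u N)) addrC; apply: le_trans (le_normcD _ _) _.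
by apply: lerD => //; exact: ltW.
Qed.

Lemma seq_cvg_sum (I : Type) (s : seq I) (u : I -> nat -> C) (l : I -> C) :
  (forall i, seq_cvg (u i) (l i)) ->
  seq_cvg (fun n => \sum_(i <- s) u i n) (\sum_(i <- s) l i).
Proof.
move=> ul; elim: s => [|i s IH].
  by apply: eq_seq_cvg (seq_cvg_cst _) => n; rewrite !big_nil.
rewrite big_cons; apply: eq_seq_cvg (seq_cvgD (ul i) IH) => n.
by rewrite big_cons.
Qed.

Lemma tsum_seq_cvg (f : nat -> C) : abs_summable f ->
  seq_cvg (fun n => \sum_(0 <= k < n) f k) (tsum f).
Proof.
move=> /abs_has_sum fs e /fs[A hA]; exists (\max_(k <- A) k).+1 => n nA.
have <- : \sum_(k <- [fset k in index_iota 0 n]%fset) f k = \sum_(0 <= k < n) f k.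
  by apply/perm_big/uniq_perm; rewrite ?fset_uniq ?iota_uniq // => k; rewrite !inE.
apply: hA; apply/fsubsetP => k kA; rewrite !inE mem_index_iota /=.
by apply: leq_ltn_trans nA; apply: leq_bigmax_seq.
Qed.

Lemma fset_sum_split (V : nmodType) (I : choiceType) (k : I -> V) (A B : {fset I}) :
  (A `<=` B)%fset ->
  \sum_(i <- B) k i = \sum_(i <- A) k i + \sum_(i <- B | i \notin A) k i.
Proof.
move=> /fsubsetP sub; rewrite (bigID (mem A)) /=; congr (_ + _).
rewrite -[LHS]big_filter; apply/perm_big/uniq_perm; rewrite ?filter_uniq //.
by move=> i; rewrite mem_filter; apply/andP/idP => [[]//|iA]; split=> //; apply: sub.
Qed.

(** Outside a large enough finite set, a bounded majorant is negligible,
    uniformly in the majorised family. *)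
Lemma uniform_tail (I : choiceType) (g : I -> R) (e : R) : 0 < e ->
  (forall i, 0 <= g i) -> bounded_sums g ->
  exists A : {fset I}, forall f : I -> C, (forall i, normc (f i) <= g i) ->
    normc (tsum f - \sum_(i <- A) f i) <= e.
Proof.
move=> e0 g0 gs; have [S hS] := has_sum_real g0 gs.
have [A hA] := hS _ (divr_gt0 e0 (ltr0n _ 2)); exists A => f fg.
have fs : abs_summable f by apply: abs_summable_le fg gs.
apply/ler_addgt0Pr => d /(abs_has_sum fs)[D hD].
have sub := fsubsetUl A D; have /hD := fsubsetUr A D; set B := (A `|` D)%fset => h.
rewrite -[tsum f](subrK (\sum_(i <- B) f i)) -addrA addrC.
apply: le_trans (le_normcD _ _) _; apply: lerD; last exact: ltW.
rewrite !(fset_sum_split _ sub) [X in normc X]addrC addKr.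
apply: le_trans (normc_sum _ _ _) _; apply: (@le_trans _ _ (\sum_(i <- B | i \notin A) g i)).
  exact: ler_sum.
have /ltW := hA B sub; have := hA A (fsubset_refl _).
rewrite -!rmorph_sum -!rmorphB !normcR (fset_sum_split _ sub).
rewrite ltr_norml ler_norml opprD addrA => /andP[h1 h2] /andP[h3 h4].
lra.
Qed.

(** Dominated convergence for sums. *)
Lemma tannery (I : choiceType) (f : nat -> I -> C) (l : I -> C) (g : I -> R) :
  (forall n i, normc (f n i) <= g i) -> bounded_sums g ->
  (forall i, seq_cvg (f^~ i) (l i)) -> seq_cvg (fun n => tsum (f n)) (tsum l).
Proof.
move=> fg gs fl e e0.
have lg i : normc (l i) <= g i by apply: seq_cvg_upper_bound (fl i).
have g0 i : 0 <= g i by apply: le_trans (normc_ge0 _) (lg i).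
have e4 : 0 < e / 4 by rewrite divr_gt0.
have [A hA] := uniform_tail e4 g0 gs.
have [N hN] := seq_cvg_sum (enum_fset A) fl (divr_gt0 e0 (ltr0n _ 2)).
exists N => n /hN; set s := \sum_(i <- _) _; set t := \sum_(i <- _) _ => st.
have h1 := hA _ lg; have h2 := hA _ (fg n); rewrite -/s in h1; rewrite -/t in h2.
have -> : tsum l - tsum (f n) = (tsum l - s) + ((s - t) + (t - tsum (f n))) by ring.
apply: le_lt_trans (le_normcD _ _) _.
have h3 := le_normcD (s - t) (t - tsum (f n)).
rewrite (normcB t) in h3; lra.
Qed.

End Limits.

(** * Infinite products *)

Section Products.
Variable R : realType.
Notation C := R[i].
Implicit Types (q x : C).

(** The partial products of [(x; q)_oo]. *)
Definition qprod x q n : C := \prod_(0 <= i < n) (1 - q ^+ i * x).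

Lemma qprod0 x q : qprod x q 0 = 1.
Proof. by rewrite /qprod big_geq. Qed.

Lemma qprodS x q n : qprod x q n.+1 = qprod x q n * (1 - q ^+ n * x).
Proof. by rewrite /qprod big_nat_recr. Qed.

Lemma qprodD x q m n : qprod x q (m + n) = qprod x q m * qprod (q ^+ m * x) q n.
Proof.
elim: n => [|n IH]; first by rewrite addn0 qprod0 mulr1.
by rewrite addnS !qprodS IH exprD mulrA; congr (_ * (1 - _)); ring.
Qed.

Lemma geom_sum_le (r : R) n : 0 <= r < 1 -> \sum_(i < n) r ^+ i <= (1 - r)^-1.
Proof.
move=> /andP[r0 r1]; rewrite -[leRHS]mul1r ler_pdivlMr ?subr_gt0 //.
by rewrite -[1 - r]opprB mulrN mulrC -subrX1 opprB lerBlDr lerDl exprn_ge0.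
Qed.

Lemma prod_lower (a : nat -> C) n : \sum_(i < n) normc (a i) <= 1 ->
  1 - \sum_(i < n) normc (a i) <= normc (\prod_(0 <= i < n) (1 - a i)).
Proof.
elim: n => [|n IH]; first by rewrite big_ord0 big_geq // subr0 normc1.
rewrite big_ord_recr big_nat_recr //= => h; set S := \sum_(i < n) _ in h IH *.
have a0 := normc_ge0 (a n); have S0 : 0 <= S by apply: sumr_ge0 => i _; apply: normc_ge0.
have {}IH : 1 - S <= normc (\prod_(0 <= i < n) (1 - a i)) by apply: IH; lra.
have h1 : 1 - normc (a n) <= normc (1 - a n).
  by rewrite lerBlDr -(@normc1 R) -{1}(subrK (a n) 1); apply: le_normcD.
rewrite normcM; apply: (@le_trans _ _ ((1 - S) * (1 - normc (a n)))); first nra.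
by apply: ler_pM => //; lra.
Qed.

Lemma prod_upper (a : nat -> C) n : \sum_(i < n) normc (a i) <= 2^-1 ->
  normc (\prod_(0 <= i < n) (1 - a i)) <= 2.
Proof.
move=> hS; suff: normc (\prod_(0 <= i < n) (1 - a i)) *
    (1 - \sum_(i < n) normc (a i)) <= 1.
  have := normc_ge0 (\prod_(0 <= i < n) (1 - a i)); nra.
elim: n hS => [|n IH]; first by rewrite big_ord0 big_geq // subr0 normc1 mulr1.
rewrite big_ord_recr big_nat_recr //= => h; set S := \sum_(i < n) _ in h IH *.
have a0 := normc_ge0 (a n); have S0 : 0 <= S by apply: sumr_ge0 => i _; apply: normc_ge0.
have {}IH : normc (\prod_(0 <= i < n) (1 - a i)) * (1 - S) <= 1 by apply: IH; lra.
have h1 : normc (1 - a n) <= 1 + normc (a n).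
  by rewrite -{1}(@normc1 R) -(normcN (a n)); apply: le_normcD.
rewrite normcM -mulrA; apply: le_trans IH; apply: ler_wpM2l; first exact: normc_ge0.
apply: (@le_trans _ _ ((1 + normc (a n)) * (1 - (S + normc (a n))))).
  by apply: ler_wpM2r => //; lra.
nra.
Qed.

Lemma exp_small (r c : R) : 0 <= r < 1 -> 0 < c ->
  exists N, forall n, (N <= n)%N -> r ^+ n <= c.
Proof.
move=> /andP[r0 r1] c0; have rn : `|r| < 1 by rewrite ger0_norm.
have := cvg_expr rn => /cvgrPdist_le/(_ _ c0)[N _ hN].
exists N => n /hN; rewrite /= sub0r normrN ger0_norm //; exact: exprn_ge0.
Qed.

(** From some rank on, the factors of the product stay within total distance
    [1/2] of [1]. *)
Lemma qprod_tail_small x q : normc q < 1 -> exists N, forall n,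
  \sum_(i < n) normc (q ^+ i * (q ^+ N * x)) <= 2^-1.
Proof.
move=> q1; have q01 : 0 <= normc q < 1 by rewrite normc_ge0.
have x0 : 0 < normc x + 1 by rewrite ltr_wpDl ?normc_ge0.
have d0 : 0 < 1 - normc q by rewrite subr_gt0.
have [N /(_ N (leqnn N)) hN] := exp_small q01
  (divr_gt0 d0 (mulr_gt0 (ltr0n R 2) x0) : 0 < (1 - normc q) / (2 * (normc x + 1))).
exists N => n; under eq_bigr do rewrite normcM normcX.
rewrite -mulr_suml; apply: (@le_trans _ _ ((1 - normc q)^-1 * (normc (q ^+ N) * (normc x + 1)))).
  rewrite normcM; apply: ler_pM.
  - by apply: sumr_ge0 => i _; rewrite exprn_ge0 ?normc_ge0.
  - by rewrite mulr_ge0 ?normc_ge0.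
  - exact: geom_sum_le.
  - by rewrite ler_wpM2l ?normc_ge0 // lerDl.
rewrite normcX mulrC ler_pdivrMr // -ler_pdivlMr //.
by apply: le_trans hN _; rewrite le_eqVlt; apply/orP; left; apply/eqP; field; lra.
Qed.

Lemma qprod_bounded x q : normc q < 1 ->
  exists2 M, 0 < M & forall n, normc (qprod x q n) <= M.
Proof.
move=> q1; have [N hN] := qprod_tail_small x q1.
have [M M0 hM] := finite_bound (qprod x q) N.+1.
exists (M * 2 + 1) => [|n]; first lra.
case: (ltnP n N) => [nN|/subnKC <-].
  by have := hM n (ltnW nN : (n < N.+1)%N); lra.
rewrite qprodD normcM; have h1 := hM _ (ltnSn N).
have h2 : normc (qprod (q ^+ N * x) q (n - N)) <= 2 by apply: prod_upper.
have := ler_pM (normc_ge0 _) (normc_ge0 _) h1 h2; lra.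
Qed.

Lemma qprod_away x q : normc q < 1 -> (forall i, 1 - q ^+ i * x != 0) ->
  exists2 d : R, 0 < d & forall n, d <= normc (qprod x q n).
Proof.
move=> q1 x0; have P0 n : 0 < normc (qprod x q n).
  rewrite normc_gt0; elim: n => [|n IH]; first by rewrite qprod0 oner_eq0.
  by rewrite qprodS mulf_neq0.
have [N hN] := qprod_tail_small x q1.
have [d d0 hd] : exists2 d : R, 0 < d & forall n, (n <= N)%N -> d <= normc (qprod x q n).
  elim: (N) => [|m [d d0 hd]]; first by exists (normc (qprod x q 0)) => // n; rewrite leqn0 => /eqP ->.
  exists (Num.min d (normc (qprod x q m.+1))) => [|n]; first by rewrite lt_min d0 P0.
  rewrite leq_eqVlt => /predU1P[->|/hd h]; first by rewrite ge_min lexx orbT.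
  by rewrite ge_min h.
exists (d / 2) => [|n]; first by rewrite divr_gt0.
case: (leqP n N) => [/hd|/ltnW/subnKC <-]; first lra.
rewrite qprodD normcM; have h1 := hd _ (leqnn N).
have h2 : 2^-1 <= normc (qprod (q ^+ N * x) q (n - N)).
  by apply: le_trans (prod_lower _); have := hN (n - N)%N; lra.
by apply: ler_pM => //; lra.
Qed.

Lemma qprod_cvg x q : normc q < 1 -> seq_cvg (qprod x q) (qpoch x q).
Proof.
move=> q1; have [M M0 hM] := qprod_bounded x q1.
(* The telescoping series of the partial products converges absolutely. *)
pose f n := qprod x q n.+1 - qprod x q n.
have fs : abs_summable f.
  have q01 : 0 <= normc q < 1 by rewrite normc_ge0.
  apply: abs_summable_le (bounded_sumsZ (_ : 0 <= M * normc x) (bounded_sums_geom q01)).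
    move=> n; rewrite /f qprodS mulrBr mulr1 addrAC subrr sub0r normcN !normcM normcX.
    have := hM n; have := normc_ge0 x; have := exprn_ge0 n (normc_ge0 q) => h1 h2 h3.
    by rewrite -mulrA [normc x * _]mulrC ler_wpM2r // mulr_ge0.
  by rewrite mulr_ge0 ?normc_ge0 ?ltW.
have fl := seq_cvgD (seq_cvg_cst 1) (tsum_seq_cvg fs).
have {}fl : seq_cvg (qprod x q) (1 + tsum f).
  apply: eq_seq_cvg fl => n; rewrite telescope_sumr // qprod0; ring.
by have -> : qpoch x q = 1 + tsum f by apply: seq_cvg_lim fl.
Qed.

Lemma qpoch_neq0 x q : normc q < 1 -> (forall i, 1 - q ^+ i * x != 0) ->
  qpoch x q != 0.
Proof.
move=> q1 /(qprod_away q1)[d d0 hd]; rewrite -normc_gt0; apply: lt_le_trans d0 _.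
exact: seq_cvg_const_bound hd (qprod_cvg x q1).
Qed.

Lemma qpoch_rec x q : normc q < 1 -> qpoch x q = (1 - x) * qpoch (q * x) q.
Proof.
move=> q1; apply: (@seq_cvg_unique _ (qprod x q \o S)).
  by apply: seq_cvg_sub (qprod_cvg x q1) => n.
apply: eq_seq_cvg (seq_cvgM (seq_cvg_cst _) (qprod_cvg (q * x) q1)) => n /=.
by rewrite -add1n qprodD qprodS qprod0 expr1 expr0 !mul1r.
Qed.

Lemma JprodE q m : normc q < 1 -> (0 < m)%N -> Jprod q m = qpoch (q ^+ m) (q ^+ m).
Proof.
move=> q1 m0; have qm1 : normc (q ^+ m) < 1 by rewrite normcX exprn_ilt1 ?normc_ge0 ?lt0n_neq0.
apply: seq_cvg_lim; apply: eq_seq_cvg (qprod_cvg (q ^+ m) qm1) => n.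
by rewrite /qprod big_add1 /=; apply: eq_bigr => i _; rewrite -exprM -exprD mulnS addnC.
Qed.

Lemma normc_sqr_lt1 q : normc q < 1 -> normc (q ^+ 2) < 1.
Proof. by move=> q1; rewrite normcX exprn_ilt1 ?normc_ge0. Qed.

Lemma qpoch_split x q : normc q < 1 ->
  qpoch x q = qpoch x (q ^+ 2) * qpoch (q * x) (q ^+ 2).
Proof.
move=> q1; have q2 := normc_sqr_lt1 q1.
apply: (@seq_cvg_unique _ (qprod x q \o double)).
  by apply: seq_cvg_sub (qprod_cvg x q1) => n; rewrite -addnn leq_addr.
apply: eq_seq_cvg (seq_cvgM (qprod_cvg x q2) (qprod_cvg (q * x) q2)).
elim=> [|n IH] /=; first by rewrite !qprod0 mulr1.
rewrite doubleS !qprodS -[qprod x q n.*2]IH -exprM -mul2n (exprS q (2 * n)); ring.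
Qed.

Lemma qpoch_opp q : normc q < 1 ->
  qpoch (- q) q * qpoch q q = qpoch (q ^+ 2) (q ^+ 2).
Proof.
move=> q1; apply: (@seq_cvg_unique _ (qprod (q ^+ 2) (q ^+ 2))).
  apply: eq_seq_cvg (seq_cvgM (qprod_cvg (- q) q1) (qprod_cvg q q1)) => n.
  rewrite /qprod -big_split; apply: eq_bigr => i _; rewrite -exprM mulnC exprM /=.
  ring.
exact/qprod_cvg/normc_sqr_lt1.
Qed.

End Products.

(** * Laurent series converging on the punctured plane *)

Lemma binz2E (n : int) : 2 * binz2 n = n * (n - 1).
Proof.
rewrite /binz2 mulrC divzK //; case: (intP n) => [//|m|m].
  have -> : m.+1%:Z - 1 = m by lia.
  by rewrite -PoszM dvdzE /= dvdn2 oddM /= andNb.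
have -> : - m.+1%:Z * (- m.+1%:Z - 1) = (m.+1 * m.+2)%N by lia.
by rewrite dvdzE /= dvdn2 oddM /= andbN.
Qed.

Lemma eq_double_int (m n : int) : 2 * m = 2 * n -> m = n.
Proof. exact: mulfI. Qed.

Lemma binz2D (m n : int) : binz2 (m + n) = binz2 m + binz2 n + m * n.
Proof. by apply: eq_double_int; rewrite !mulrDr !binz2E; ring. Qed.

Lemma binz2_0 : binz2 0 = 0. Proof. by []. Qed.
Lemma binz2_1 : binz2 1 = 0. Proof. by []. Qed.

Lemma binz2S (n : int) : binz2 (n + 1) = binz2 n + n.
Proof. by rewrite binz2D binz2_1 addr0 mulr1. Qed.

Lemma binz2N (n : int) : binz2 (- n) = binz2 n + n.
Proof. by apply: eq_double_int; rewrite !mulrDr !binz2E; ring. Qed.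

Lemma int_step_ind (P : int -> Prop) : P 0 ->
  (forall n, P n <-> P (n + 1)) -> forall n, P n.
Proof.
move=> P0 PS; elim/int_rect => // n.
  by move/PS; rewrite addrC -intS.
by move=> Pn; apply/PS; have -> : - n.+1%:Z + 1 = - n%:Z by lia.
Qed.

(** Two solutions of the same first-order recurrence over [int] are
    proportional. *)
Lemma recurrence_unique (F : fieldType) (rho a b : int -> F) :
  (forall n, rho n != 0) -> (forall n, a (n + 1) = rho n * a n) ->
  (forall n, b (n + 1) = rho n * b n) -> b 0 = 1 ->
  forall n, a n = a 0 * b n.
Proof.
move=> r0 ha hb b0; apply: int_step_ind; first by rewrite b0 mulr1.
move=> n; rewrite ha hb mulrCA; split=> [->|/(mulfI (r0 n))] //.
Qed.

Section Theta_bounds.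
Variable R : realType.

Lemma ratio_bounded (g : nat -> R) N : (forall n, 0 <= g n) ->
  (forall n, (N <= n)%N -> g n.+1 <= g n / 2) -> bounded_sums g.
Proof.
move=> g0 hg; apply: (@bounded_sums_nat _ _ (\sum_(i < N) g i + 2 * g N)) => // n.
have h k : \sum_(i < N + k) g i + 2 * g (N + k)%N <= \sum_(i < N) g i + 2 * g N.
  elim: k => [|k IH]; first by rewrite addn0.
  rewrite addnS big_ord_recr /=; have := hg _ (leq_addr k N); lra.
case: (leqP n N) => [nN|/ltnW/subnKC <-].
  rewrite -(subnKC nN) big_split_ord /= -addrA lerDl addr_ge0 ?sumr_ge0 //.
  by rewrite mulr_ge0.
by have := h (n - N)%N; have := g0 (N + (n - N))%N; lra.
Qed.

Lemma theta_bounded_nat (r X : R) : 0 < r < 1 -> 0 < X ->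
  bounded_sums (fun n : nat => r ^ binz2 n * X ^ n).
Proof.
move=> /andP[r0 r1] X0.
have r01 : 0 <= r < 1 by rewrite ltW.
have X2 : 0 < (2 * X)^-1 by rewrite invr_gt0 mulr_gt0.
have [N hN] := exp_small r01 X2.
apply: (@ratio_bounded _ N) => n.
  by rewrite mulr_ge0 // exprz_ge0 // ltW.
move=> /hN h; have -> : n.+1%:Z = n%:Z + 1 by lia.
rewrite binz2S !expfzDr ?gt_eqF // expr1z.
have -> : r ^ binz2 n * r ^ n * (X ^ n * X) = r ^ binz2 n * X ^ n * (r ^+ n * X).
  by rewrite -[r ^ n]/(r ^+ n); ring.
apply: ler_wpM2l; first by rewrite mulr_ge0 // exprz_ge0 // ltW.
by rewrite -ler_pdivlMr // -invfM.
Qed.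

Lemma theta_bounded (r X : R) : 0 < r < 1 -> 0 < X ->
  bounded_sums (fun n : int => r ^ binz2 n * X ^ n).
Proof.
move=> r01 X0; have /andP[r0 r1] := r01.
apply: bounded_sums_int.
- by move=> n; rewrite mulr_ge0 // exprz_ge0 // ltW.
- exact: theta_bounded_nat.
have := bounded_sums_inj succn_inj (theta_bounded_nat r01 (divr_gt0 r0 X0)).
apply: bounded_sums_le => n /=; rewrite NegzE binz2N expfzDr ?gt_eqF //.
by rewrite expfzMl exprz_inv mulrA.
Qed.

End Theta_bounds.

Section Laurent.
Variable R : realType.
Notation C := R[i].
Implicit Types (H G : C -> C) (h g : int -> C).

(** [expands H h]: on the punctured plane [H] is the sum of the absolutely
    convergent Laurent series with coefficients [h]. *)
Definition expands H h : Prop := forall x, x != 0 ->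
  abs_summable (fun n => h n * x ^ n) /\ H x = tsum (fun n => h n * x ^ n).

Definition laurent H : Prop := exists h, expands H h.

Lemma eq_laurent H G : (forall x, x != 0 -> H x = G x) -> laurent H -> laurent G.
Proof.
by move=> HG [h hH]; exists h => x x0; rewrite -HG //; apply: hH.
Qed.

Lemma expandsD H G h g : expands H h -> expands G g ->
  expands (fun x => H x + G x) (fun n => h n + g n).
Proof.
move=> hH gG x x0; have [hs ->] := hH _ x0; have [gs ->] := gG _ x0.
have e : (fun n => h n * x ^ n + g n * x ^ n) =1 (fun n => (h n + g n) * x ^ n).
  by move=> n; rewrite mulrDl.
split; first exact: eq_abs_summable e (abs_summableD hs gs).
by rewrite -tsumD //; apply: eq_tsum.
Qed.

Lemma expandsZ c H h : expands H h -> expands (fun x => c * H x) (fun n => c * h n).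
Proof.
move=> hH x x0; have [hs ->] := hH _ x0.
have e : (fun n => c * (h n * x ^ n)) =1 (fun n => c * h n * x ^ n).
  by move=> n; rewrite mulrA.
split; first exact: eq_abs_summable e (abs_summableZ c hs).
by rewrite -tsumZ //; apply: eq_tsum.
Qed.

Lemma expands_dilate c H h : c != 0 -> expands H h ->
  expands (fun x => H (c * x)) (fun n => h n * c ^ n).
Proof.
move=> c0 hH x x0; have [hs ->] := hH _ (mulf_neq0 c0 x0).
have e : (fun n => h n * (c * x) ^ n) =1 (fun n => h n * c ^ n * x ^ n).
  by move=> n; rewrite expfzMl mulrA.
by split; [exact: eq_abs_summable e hs|exact: eq_tsum].
Qed.

Lemma addz_bij (d : int) : bijective (fun n : int => n + d).
Proof. by exists (fun n => n - d) => n; rewrite ?addrK ?subrK. Qed.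

Lemma expands_shift (d : int) H h : expands H h ->
  expands (fun x => x ^ d * H x) (fun n => h (n - d)).
Proof.
move=> hH x x0; have [hs ->] := hH _ x0.
have e : (fun n => x ^ d * (h (n - d) * x ^ (n - d))) =1 (fun n => h (n - d) * x ^ n).
  by move=> n; rewrite mulrCA -expfzDr // [d + _]addrC subrK.
have hs' := abs_summable_inj (bij_inj (addz_bij (- d))) hs.
split; first exact: eq_abs_summable e (abs_summableZ _ hs').
by rewrite (tsum_bij (addz_bij (- d)) hs) -tsumZ //; apply: eq_tsum.
Qed.

Lemma expandsM H G h g : expands H h -> expands G g ->
  expands (fun x => H x * G x) (fun n => tsum (fun k => h k * g (n - k))).
Proof.
move=> hH gG.
pose sw (p : int * int) := (p.2, p.1 - p.2).
have swB : bijective sw.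
  exists (fun p => (p.1 + p.2, p.1)) => -[a b]; rewrite /sw /=.
    by congr pair; ring.
  by congr pair; ring.
have conv x : x != 0 -> abs_summable (fun p : int * int =>
    h p.2 * g (p.1 - p.2) * x ^ p.1) /\
    tsum (fun p : int * int => h p.2 * g (p.1 - p.2) * x ^ p.1) = H x * G x.
  move=> x0; have [hs ->] := hH _ x0; have [gs ->] := gG _ x0.
  have ps := abs_summable_prod hs gs.
  have e : (fun p : int * int => h p.1 * x ^ p.1 * (g p.2 * x ^ p.2)) \o sw =1
      (fun p : int * int => h p.2 * g (p.1 - p.2) * x ^ p.1).
    by move=> [n k] /=; rewrite mulrACA -expfzDr // [k + _]addrC subrK.
  split; first exact: eq_abs_summable e (abs_summable_inj (bij_inj swB) ps).
  by rewrite -tsum_prod // (tsum_bij swB ps); apply: eq_tsum => p; rewrite -e.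
move=> x x0; have [ps pE] := conv x x0.
have e n : tsum (fun k => h k * g (n - k) * x ^ n) =
    tsum (fun k => h k * g (n - k)) * x ^ n.
  rewrite mulrC -tsumZ; first by apply: eq_tsum => k; rewrite mulrC.
  have [ps1 _] := conv 1 (oner_neq0 _).
  apply: eq_abs_summable (abs_summable_row n ps1) => k /=.
  by rewrite exp1rz mulr1.
split.
  by apply: eq_abs_summable (abs_summable_tsum ps) => n /=; rewrite e.
by rewrite -pE tsum_pair //; apply: eq_tsum => n; rewrite /= e.
Qed.

Lemma laurentD H G : laurent H -> laurent G -> laurent (fun x => H x + G x).
Proof. by move=> [h hH] [g gG]; exists (fun n => h n + g n); apply: expandsD. Qed.

Lemma laurentZ c H : laurent H -> laurent (fun x => c * H x).
Proof. by move=> [h hH]; exists (fun n => c * h n); apply: expandsZ. Qed.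

Lemma laurentB H G : laurent H -> laurent G -> laurent (fun x => H x - G x).
Proof.
move=> hH /(laurentZ (-1)) hG; apply: eq_laurent (laurentD hH hG) => x _.
by rewrite mulN1r.
Qed.

Lemma laurentM H G : laurent H -> laurent G -> laurent (fun x => H x * G x).
Proof. by move=> [h hH] [g gG]; eexists; apply: expandsM hH gG. Qed.

Lemma laurent_dilate c H : c != 0 -> laurent H -> laurent (fun x => H (c * x)).
Proof. by move=> c0 [h hH]; eexists; apply: expands_dilate hH. Qed.

Lemma laurent_opp H : laurent H -> laurent (fun x => H (- x)).
Proof.
move=> hH; apply: eq_laurent (laurent_dilate (_ : -1 != 0) hH) => [x _|].
  by rewrite mulN1r.
by rewrite oppr_eq0 oner_eq0.
Qed.

Lemma even_part (h : int -> C) x : x != 0 ->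
  abs_summable (fun n => h n * x ^ n) -> abs_summable (fun n => h n * (- x) ^ n) ->
  tsum (fun n => h n * x ^ n) + tsum (fun n => h n * (- x) ^ n) =
  2 * tsum (fun n => h (2 * n) * x ^ (2 * n)).
Proof.
move=> x0 hs hsN; rewrite -tsumD //.
have i2 : injective (fun n : int => 2 * n) by move=> m n /mulfI ->.
have hs2 := abs_summable_inj i2 hs.
apply: has_sum_tsum; apply: (proj1 (@has_sum_inj _ _ _ (fun n => 2 * n) _ _ i2 _)).
  move=> n n2; have : (-1 : C) ^ n = -1.
    have : ~~ (2 %| n)%Z.
      by apply/negP => /dvdzP[m nm]; move: (n2 m); rewrite nm mulrC eqxx.
    case: n {n2} => n; rewrite dvdzE /= dvdn2 negbK => on.
      by rewrite -exprnP -signr_odd on.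
    by rewrite -[(-1) ^ Negz n]/(((-1) ^+ n.+1)^-1) -signr_odd on expr1 invrN1.
  by move=> e; rewrite [(- x) ^ n]expNrz e; ring.
apply: has_sum_ext (has_sumZ 2 (abs_has_sum hs2)) => n /=.
have s1 : (-1 : C) ^ (2 * n) = 1.
  by rewrite -exprz_exp -[(-1) ^ 2]/((-1) ^+ 2) sqrrN expr1n exp1rz.
by rewrite [(- x) ^ _]expNrz s1; ring.
Qed.

Lemma mul2z_inj : injective (fun n : int => 2 * n).
Proof. exact: mulfI. Qed.

Lemma expands0_even (h : int -> C) :
  (forall x, x != 0 -> abs_summable (fun n => h n * x ^ n)) ->
  (forall x, x != 0 -> tsum (fun n => h n * x ^ n) = 0) ->
  forall k, tsum (fun n : int => h (2 ^+ k * n)) = 0.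
Proof.
move=> hs h0 k.
suff: (forall x, x != 0 -> abs_summable (fun n => h (2 ^+ k * n) * x ^ n)) /\
      (forall x, x != 0 -> tsum (fun n => h (2 ^+ k * n) * x ^ n) = 0).
  move=> [_ /(_ 1 (oner_neq0 _)) h1]; rewrite -[RHS]h1.
  by apply: eq_tsum => n; rewrite exp1rz mulr1.
elim: k => [|k [IHs IH]].
  split=> x x0; [apply: eq_abs_summable (hs _ x0)|rewrite -[RHS](h0 _ x0); apply: eq_tsum];
  by move=> n; rewrite expr0 mul1r.
have e x : (fun n : int => h (2 ^+ k * (2 * n)) * sqrtc x ^ (2 * n)) =1
    (fun n => h (2 ^+ k.+1 * n) * x ^ n).
  by move=> n; rewrite -exprz_exp -[sqrtc x ^ 2]/(sqrtc x ^+ 2) sqr_sqrtc mulrA -exprSr.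
split=> x x0; (have y0 : sqrtc x != 0 by rewrite sqrtc_eq0).
  apply: eq_abs_summable (e x) _.
  exact: (abs_summable_inj mul2z_inj (IHs _ y0)).
have yN : - sqrtc x != 0 by rewrite oppr_eq0.
rewrite -(eq_tsum (e x)); have := even_part y0 (IHs _ y0) (IHs _ yN).
rewrite !IH // addr0 => /esym/eqP; rewrite mulf_eq0 pnatr_eq0 /= => /eqP.
exact.
Qed.

(** The constant coefficient is recovered by averaging over the [2^k]-th roots
    of unity and letting [k] grow. *)
Lemma expands0_coef0 H h : expands H h -> (forall x, x != 0 -> H x = 0) -> h 0 = 0.
Proof.
move=> hH H0; have hs x : x != 0 -> abs_summable (fun n => h n * x ^ n).
  by move=> /hH[].
have h0 x : x != 0 -> tsum (fun n => h n * x ^ n) = 0.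
  by move=> x0; rewrite -(H0 _ x0); have [_ ->] := hH _ x0.
have hs1 : abs_summable h.
  by apply: eq_abs_summable (hs _ (oner_neq0 _)) => n; rewrite exp1rz mulr1.
(* [f k] keeps the coefficients whose index is divisible by [2^k]; its sum is
   zero for every [k], and tends to [h 0]. *)
pose f k (n : int) := if (2 ^+ k %| n)%Z then h n else 0.
have f0 k : tsum (f k) = 0.
  rewrite -[RHS](expands0_even hs h0 k).
  have i2 : injective (fun n : int => 2 ^+ k * n) by apply/mulfI/expf_neq0.
  apply: has_sum_tsum; apply: (proj1 (@has_sum_inj _ _ _ (fun n => 2 ^+ k * n) _ _ i2 _)).
    move=> n nk; rewrite /f; case: ifP => // /dvdzP[m nm].
    by move: (nk m); rewrite nm mulrC eqxx.
  apply: has_sum_ext (abs_has_sum (abs_summable_inj i2 hs1)) => n /=.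
  by rewrite /f dvdz_mulr.
have fl : seq_cvg (fun k => tsum (f k)) (tsum (fun n : int => if n == 0 then h 0 else 0)).
  apply: (@tannery _ _ _ _ (fun n => normc (h n))) hs1 _ => [k n|n].
    by rewrite /f; case: ifP => _ //; rewrite normc0 normc_ge0.
  have [->|n0] := eqVneq n 0.
    by apply: eq_seq_cvg (seq_cvg_cst _) => k; rewrite /f dvdz0.
  move=> e e0; exists `|n|%N => k kn; rewrite /f ifF ?subrr ?normc0 //.
  apply/negP; rewrite dvdzE /= abszX /= => /dvdn_leq; rewrite absz_gt0 n0.
  move=> /(_ isT); apply/negP; rewrite -ltnNge; apply: leq_ltn_trans kn _.
  exact: ltn_expl.
rewrite -(seq_cvg_unique fl (eq_seq_cvg (fun k => esym (f0 k)) (seq_cvg_cst 0))).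
by rewrite (@tsum_single _ _ _ 0) ?eqxx // => n /negbTE ->.
Qed.

Lemma expands_unique H h g : expands H h -> expands H g -> h =1 g.
Proof.
move=> hH gH m; apply/eqP; rewrite -subr_eq0 -mulN1r; apply/eqP.
have := expands_shift (- m) (expandsD hH (expandsZ (-1) gH)).
move=> /expands0_coef0 /=; rewrite sub0r opprK; apply => x x0.
by rewrite mulN1r subrr mulr0.
Qed.

End Laurent.

(** * The Jacobi triple product *)

(** Triangular numbers. *)
Definition tri (m : nat) : nat := 'C(m.+1, 2).

Lemma triS m : tri m.+1 = (tri m + m.+1)%N.
Proof. by rewrite /tri binS bin1. Qed.

Lemma triD m n : tri (m + n) = (tri m + tri n + m * n)%N.
Proof.
elim: n => [|n IH]; first by rewrite addn0 muln0 addn0 -[tri 0]/0%N addn0.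
by rewrite addnS !triS IH mulnS; lia.
Qed.

Lemma tri_binz2 (m : nat) : (tri m)%:Z = binz2 m + m%:Z.
Proof.
elim: m => [//|m IH]; have e : m.+1%:Z = m%:Z + 1 by lia.
by rewrite triS PoszD IH [in RHS]e binz2S e.
Qed.

Lemma tri_absz_ge (k : int) :
  (binz2 k <= (tri `|k|)%:Z) && (binz2 k + k <= (tri `|k|)%:Z).
Proof.
case: k => m; rewrite tri_binz2 /=; first by lia.
by rewrite NegzE binz2N; lia.
Qed.

Section Jacobi.
Variable R : realType.
Notation C := R[i].
Variable p : C.
Hypotheses (p0 : p != 0) (p1 : normc p < 1).

(** The product [(p; p)_n], its inverse, and the inverse of [(p; p)_(n - m)],
    which is [0] for [m > n] by convention. *)
Definition qfact n : C := qprod p p n.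
Definition qfact_inv n : C := (qfact n)^-1.
Definition qfact_inv_sub n m : C := if (m <= n)%N then qfact_inv (n - m) else 0.
Local Notation Q := qfact.
Local Notation U := qfact_inv.
Local Notation V := qfact_inv_sub.

Lemma one_sub_exp_neq0 n : (0 < n)%N -> 1 - p ^+ n != 0.
Proof.
move=> n0; rewrite subr_eq0; apply: contraTneq isT => e.
have : normc (p ^+ n) < 1 by rewrite normcX exprn_ilt1 ?normc_ge0 // -lt0n.
by rewrite -e normc1 ltxx.
Qed.

Lemma qfact_neq0 n : Q n != 0.
Proof.
elim: n => [|n IH]; first by rewrite /Q qprod0 oner_neq0.
by rewrite /Q qprodS mulf_neq0 // -exprSr one_sub_exp_neq0.
Qed.

Lemma qfactS n : Q n.+1 = Q n * (1 - p ^+ n.+1).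
Proof. by rewrite /Q qprodS exprSr. Qed.

Lemma qfact_inv_rec n : U n = (1 - p ^+ n.+1) * U n.+1.
Proof.
by rewrite /U qfactS invfM mulrCA divff ?mulr1 ?one_sub_exp_neq0.
Qed.

(** The symmetric Laurent polynomial with exponents from [- m] to [m]. *)
Fixpoint chi (m : nat) (x : C) : C :=
  if m is k.+1 then chi k x + x ^+ k.+1 + x ^- k.+1 else 1.

(** The coefficients of the finite triple product in the basis [chi m]:
    [(-1)^m p^(m (m + 1) / 2)] times the q-binomial coefficient
    [2 n + 1] choose [n - m]. *)
Definition bcoef n m : C :=
  (-1) ^+ m * p ^+ tri m * Q (2 * n).+1 * U (n + m).+1 * V n m.

(** The left neighbour of a sequence, extended to [-1] by antisymmetry
    since the recurrence [chi_mul] would make [chi (-1) = - chi 0]. *)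
Definition pred_odd (b : nat -> C) m : C := if m is k.+1 then b k else - b 0.

Lemma bcoef_gt n m : (n < m)%N -> bcoef n m = 0.
Proof. by move=> nm; rewrite /bcoef /V leqNgt nm mulr0. Qed.

Lemma qfact_inv_subSS n m : V n.+1 m.+1 = V n m.
Proof. by rewrite /V ltnS subSS. Qed.

Lemma qfact_inv_sub_rec n m : (m <= n)%N -> V n m.+1 = (1 - p ^+ (n - m)) * V n m.
Proof.
move=> mn; rewrite /V mn; case: ltnP => [lt_mn|nm].
  by rewrite qfact_inv_rec subnSK.
have -> : (n - m)%N = 0%N by apply/eqP; rewrite subn_eq0.
by rewrite expr0 subrr mul0r.
Qed.

Lemma bcoef_rec n m : bcoef n.+1 m =
  (1 + p ^+ (2 * n.+1)) * bcoef n m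
  - p ^+ n.+1 * (pred_odd (bcoef n) m + bcoef n m.+1).
Proof.
have QE : Q (2 * n.+1).+1 = Q (2 * n).+1 * (1 - p ^+ (2 * n.+1)) * (1 - p * p ^+ (2 * n.+1)).
  have -> : (2 * n.+1 = (2 * n).+2)%N by lia.
  by rewrite qfactS [Q (2 * n).+2]qfactS -[p * _]exprS.
case: m => [|k].
  rewrite /bcoef /pred_odd /bcoef QE !addn0 !addn1 qfact_inv_sub_rec // subn0 /V !leq0n !subn0.
  rewrite (qfact_inv_rec n) (qfact_inv_rec n.+1); set a := U n.+2; set b := U n.+1; set q := Q _.
  have -> : p ^+ (2 * n.+1) = p ^+ n.+1 ^+ 2 by rewrite mulnC exprM.
  rewrite [p ^+ n.+2]exprS; have -> : p ^+ n = p ^+ n.+1 / p by rewrite exprSr mulfK.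
  rewrite -[tri 1]/1%N -[tri 0]/0%N; field; exact: p0.
have [kn|nk] := leqP k n; last first.
  have z i : (k <= i)%N -> bcoef n i = 0 by move=> ki; apply: bcoef_gt; lia.
  by rewrite /pred_odd !z ?bcoef_gt //; [ring|lia..].
have VE : V n k.+2 = (1 - p ^+ (n - k) / p) * (1 - p ^+ (n - k)) * V n k.
  move: kn; rewrite leq_eqVlt => /predU1P[->|kn].
    by rewrite subnn expr0 subrr mulr0 mul0r /V ifF //; apply/negP; lia.
  rewrite qfact_inv_sub_rec // qfact_inv_sub_rec ?(ltnW kn) // mulrA; congr ((1 - _) * _ * _).
  by rewrite -(subnSK kn) exprSr mulfK.
rewrite /bcoef /pred_odd /bcoef QE qfact_inv_subSS VE qfact_inv_sub_rec //; set v := V n k.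
have -> : (n.+1 + k.+1).+1 = (n + k).+3 by lia.
have -> : (n + k.+1).+1 = (n + k).+2 by lia.
have -> : (n + k.+2).+1 = (n + k).+3 by lia.
rewrite (qfact_inv_rec (n + k).+1) (qfact_inv_rec (n + k).+2); set a := U (n + k).+3; set q := Q _.
set M := p ^+ k.+1; set A := p ^+ (n - k).
have -> : p ^+ (2 * n.+1) = (A * M) ^+ 2.
  by rewrite /A /M -exprD -exprM; congr (_ ^+ _); lia.
have -> : p ^+ n.+1 = A * M by rewrite /A /M -exprD; congr (_ ^+ _); lia.
have -> : p ^+ (n + k).+3 = p * (A * M ^+ 2).
  by rewrite /A /M -exprM -exprD -exprS; congr (_ ^+ _); lia.
have -> : p ^+ (n + k).+2 = A * M ^+ 2.
  by rewrite /A /M -exprM -exprD; congr (_ ^+ _); lia.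
have M0 : M != 0 by apply: expf_neq0.
have t1 : p ^+ tri k.+1 = p ^+ tri k * M by rewrite triS exprD.
have -> : p ^+ tri k.+2 = p ^+ tri k * M * (p * M) by rewrite triS exprD t1 -exprS.
rewrite t1 [(-1) ^+ k.+1]exprS [(-1) ^+ k.+2]exprS [(-1) ^+ k.+1]exprS; field.
exact: p0.
Qed.

Lemma chi_mul x m : x != 0 ->
  (x + x^-1) * chi m.+1 x = chi m.+2 x + chi m x.
Proof.
move=> x0; elim: m => [|m IH].
  by rewrite /= !exprS !expr0; field.
have e k : chi k.+1 x = chi k x + x ^+ k.+1 + x ^- k.+1 by [].
transitivity ((x + x^-1) * chi m.+1 x + (x + x^-1) * (x ^+ m.+2 + x ^- m.+2)).
  by rewrite (e m.+1); ring.
rewrite IH (e m.+2) (e m) !exprS; field.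
by rewrite x0 expf_neq0.
Qed.

Lemma chi_sum_mul x (b : nat -> C) N : x != 0 ->
  (x + x^-1) * \sum_(m < N.+1) b m * chi m x =
  \sum_(m < N.+1) (pred_odd b m + b m.+1) * chi m x
  + b N * chi N.+1 x - b N.+1 * chi N x.
Proof.
move=> x0; elim: N => [|N IH].
  by rewrite !big_ord_recr !big_ord0 /= expr1; field.
rewrite big_ord_recr mulrDr IH [in RHS]big_ord_recr /=.
rewrite mulrCA (chi_mul N x0) /=; ring.
Qed.

Lemma finite_triple_product n x : x != 0 ->
  qprod (p * x) p n * qprod (p / x) p n = \sum_(m < n.+1) bcoef n m * chi m x.
Proof.
move=> x0; elim: n => [|n IH].
  rewrite !qprod0 big_ord_recr big_ord0 /= /bcoef /V /U /= muln0 addn0 subnn.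
  rewrite add0r expr0 !mul1r mulr1 divff ?qfact_neq0 // /Q qprod0 invr1.
  by rewrite mulr1.
rewrite !qprodS; have -> : qprod (p * x) p n * (1 - p ^+ n * (p * x)) *
    (qprod (p / x) p n * (1 - p ^+ n * (p / x))) =
    (1 + p ^+ (2 * n.+1)) * (qprod (p * x) p n * qprod (p / x) p n)
    - p ^+ n.+1 * ((x + x^-1) * (qprod (p * x) p n * qprod (p / x) p n)).
  have -> : p ^+ (2 * n.+1) = (p * p ^+ n) ^+ 2 by rewrite -exprS mulnC exprM.
  by rewrite [p ^+ n.+1]exprS; field.
rewrite IH (chi_sum_mul _ _ x0) (bcoef_gt (ltnSn n)).
rewrite [in RHS]big_ord_recr /= bcoef_rec (bcoef_gt (ltnSn n)) (bcoef_gt (leqnSn n.+1)) /=.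
have -> : \sum_(m < n.+1) bcoef n.+1 m * chi m x =
    (1 + p ^+ (2 * n.+1)) * (\sum_(m < n.+1) bcoef n m * chi m x) -
    p ^+ n.+1 * \sum_(m < n.+1) (pred_odd (bcoef n) m + bcoef n m.+1) * chi m x.
  rewrite !mulr_sumr -sumrB; apply: eq_bigr => m _.
  by rewrite bcoef_rec mulrBl -!(mulrA _ _ (chi m x)).
ring.
Qed.


Local Notation J := (qpoch p p).

Lemma qpoch_self_neq0 : J != 0.
Proof. by apply: qpoch_neq0 => // i; rewrite -exprSr one_sub_exp_neq0. Qed.

Lemma qfact_cvg : seq_cvg Q J.
Proof. exact: qprod_cvg. Qed.

Lemma qfact_inv_cvg : seq_cvg U J^-1.
Proof. exact: seq_cvgV qpoch_self_neq0 qfact_cvg. Qed.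

Lemma qfact_inv_sub_cvg m : seq_cvg (V^~ m) J^-1.
Proof.
move=> e /qfact_inv_cvg[N hN]; exists (N + m)%N => n nN.
by rewrite /V ifT ?hN //; lia.
Qed.

Lemma bcoef_cvg m : seq_cvg (bcoef^~ m) ((-1) ^+ m * p ^+ tri m / J).
Proof.
have hQ : seq_cvg (fun n => Q (2 * n).+1) J.
  by apply: (seq_cvg_sub (s := fun n => (2 * n).+1)) qfact_cvg => n; lia.
have hU : seq_cvg (fun n => U (n + m).+1) J^-1.
  by apply: (seq_cvg_sub (s := fun n => (n + m).+1)) qfact_inv_cvg => n; lia.
have := seq_cvgM (seq_cvgM (seq_cvgM (seq_cvg_cst ((-1) ^+ m * p ^+ tri m)) hQ) hU)
  (qfact_inv_sub_cvg m).
by rewrite (mulfK qpoch_self_neq0).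
Qed.

Lemma bcoef_bound : exists2 K : R, 0 <= K &
  forall n m, normc (bcoef n m) <= K * normc p ^+ tri m.
Proof.
have [M M0 hM] := seq_cvg_bounded qfact_cvg.
have [D D0 hD] := seq_cvg_bounded qfact_inv_cvg.
have hV n m : normc (V n m) <= D by rewrite /V; case: ifP => _ //; rewrite normc0 ltW.
exists (M * D * D) => [|n m]; first by rewrite !mulr_ge0 // ltW.
rewrite /bcoef !normcM !normcX normcN normc1 expr1n mul1r [leRHS]mulrC -!mulrA.
apply: ler_wpM2l; first by rewrite exprn_ge0 ?normc_ge0.
by apply: ler_pM; rewrite ?mulr_ge0 ?normc_ge0 // ler_pM ?normc_ge0.
Qed.

Lemma chi_bound m x : x != 0 ->
  normc (chi m x) <= (1 + normc x + (normc x)^-1) ^+ m.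
Proof.
move=> x0; set a := normc x; have a0 : 0 < a by rewrite normc_gt0.
have b0 : 0 < a^-1 by rewrite invr_gt0.
set b := a^-1 in b0 *; set Y := 1 + a + b.
have Y0 : 0 <= Y by rewrite /Y; lra.
elim: m => [|m IH]; first by rewrite expr0 normc1.
apply: le_trans (le_normcD _ _) _; apply: (@le_trans _ _ (Y ^+ m + Y ^+ m * a + Y ^+ m * b)).
  apply: lerD.
    apply: le_trans (le_normcD _ _) _; apply: lerD IH _.
    rewrite normcX -/a exprSr; apply: ler_wpM2r; first exact: ltW.
    by apply: lerXn2r; rewrite ?nnegrE ?ltW // /Y; lra.
  rewrite normcV normcX -/a -exprVn -/b exprSr; apply: ler_wpM2r; first exact: ltW.
  by apply: lerXn2r; rewrite ?nnegrE ?ltW // /Y; lra.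
by rewrite le_eqVlt; apply/orP; left; apply/eqP; rewrite exprSr /Y; ring.
Qed.

Lemma p_norm01 : 0 < normc p < 1.
Proof. by rewrite normc_gt0 p0. Qed.

Lemma exprz_antimono (r : R) (m n : int) : 0 < r < 1 -> m <= n -> r ^ n <= r ^ m.
Proof.
move=> /andP[r0 r1]; rewrite -subr_ge0 -{2}(subrK m n) expfzDr ?gt_eqF //.
move: (n - m) => -[d _|//]; rewrite ler_piMl ?exprz_ge0 ?(ltW r0) //.
by apply: exprn_ile1; apply: ltW.
Qed.

Lemma tri_bounded (X : R) : 0 < X ->
  bounded_sums (fun m : nat => normc p ^+ tri m * X ^+ m).
Proof.
move=> X0; have [a0 _] := andP p_norm01.
apply: bounded_sums_le (theta_bounded_nat p_norm01 (mulr_gt0 a0 X0)) => m.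
rewrite -[_ ^+ tri m]/(_ ^ (tri m)%:Z) tri_binz2 expfzDr ?gt_eqF // expfzMl.
by rewrite mulrA.
Qed.

(** [jtheta x p / (1 - x)], as a function without singularity at [1]. *)
Definition theta0 (x : C) : C := qpoch (p * x) p * qpoch (p / x) p * J.

Lemma triple_product x : x != 0 ->
  theta0 x = tsum (fun m : nat => (-1) ^+ m * p ^+ tri m * chi m x).
Proof.
move=> x0; set Y := 1 + normc x + (normc x)^-1.
have a0 : 0 < normc x by rewrite normc_gt0.
have Y0 : 0 < Y by rewrite /Y; have := invr_gt0 (normc x); rewrite a0; lra.
have [K K0 hK] := bcoef_bound.
have majs := bounded_sumsZ K0 (tri_bounded Y0).
have lim1 : seq_cvg (fun n => tsum (fun m => bcoef n m * chi m x))
    (tsum (fun m : nat => (-1) ^+ m * p ^+ tri m / J * chi m x)).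
  apply: tannery majs _ => [n m|m].
    rewrite normcM mulrA; apply: ler_pM; rewrite ?normc_ge0 //.
    exact: chi_bound.
  exact: seq_cvgM (bcoef_cvg m) (seq_cvg_cst _).
have lim2 := seq_cvgM (qprod_cvg (p * x) p1) (qprod_cvg (p / x) p1).
have fin n : tsum (fun m => bcoef n m * chi m x) =
    qprod (p * x) p n * qprod (p / x) p n.
  rewrite finite_triple_product // (@tsum_nat_finite _ _ n.+1) // => m nm.
  by rewrite bcoef_gt // mul0r.
rewrite /theta0 (seq_cvg_unique lim2 (eq_seq_cvg fin lim1)) mulrC -tsumZ.
  by apply: eq_tsum => m; rewrite mulrA [J * _]mulrC divfK ?qpoch_self_neq0.
apply: abs_summable_le (bounded_sumsZ (normc_ge0 J^-1) (tri_bounded Y0)) => m.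
rewrite !normcM !normcX normcN normc1 expr1n mul1r mulrAC mulrC.
by rewrite ler_wpM2l ?normc_ge0 // ler_wpM2l ?exprn_ge0 ?normc_ge0 // chi_bound.
Qed.

(** The Laurent coefficients of [theta0]. *)
Definition theta0_coef (k : int) : C :=
  tsum (fun i : nat => (-1) ^+ (`|k| + i) * p ^+ tri (`|k| + i)).

Lemma tri_bounded1 : bounded_sums (fun i : nat => normc p ^+ tri i).
Proof.
by apply: bounded_sums_le (tri_bounded ltr01) => i; rewrite expr1n mulr1.
Qed.

Lemma tri_norm_le (a i : nat) :
  normc ((-1) ^+ (a + i) * p ^+ tri (a + i)) <= normc p ^+ tri a * normc p ^+ tri i.
Proof.
have [a0 a1] := andP p_norm01.
rewrite normcM !normcX normcN normc1 expr1n mul1r -exprD.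
by apply: ler_wiXn2l; rewrite ?ltW // triD leq_addr.
Qed.

(** The gain [tri `|k|] in the exponent is what makes all the Laurent series
    below converge on the whole punctured plane. *)
Lemma theta0_coef_bound : exists2 K : R, 0 <= K &
  forall k, normc (theta0_coef k) <= K * normc p ^+ tri `|k|.
Proof.
have [M hM] := tri_bounded1; exists M => [|k].
  by have := hM fset0; rewrite big_seq_fset0.
have maj := bounded_sumsZ (exprn_ge0 (tri `|k|) (normc_ge0 p)) tri_bounded1.
apply: normc_tsum => [|A].
  by apply: abs_summable_le maj => i; apply: tri_norm_le.
apply: (@le_trans _ _ (\sum_(i <- A) normc p ^+ tri `|k| * normc p ^+ tri i)).
  by apply: ler_sum => i _; apply: tri_norm_le.
by rewrite -mulr_sumr mulrC ler_wpM2r // exprn_ge0 ?normc_ge0.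
Qed.

Lemma theta0_coefS (n : nat) :
  theta0_coef n = (-1) ^+ n * p ^+ tri n + theta0_coef n.+1.
Proof.
have fs : abs_summable (fun i : nat => (-1) ^+ (n + i) * p ^+ tri (n + i)).
  apply: abs_summable_le (bounded_sumsZ (exprn_ge0 (tri n) (normc_ge0 p)) tri_bounded1) => i.
  exact: tri_norm_le.
have single (c : C) : tsum (fun i : nat => if i == 0%N then c else 0) = c.
  by rewrite (@tsum_single _ _ _ 0%N) ?eqxx // => i /negbTE ->.
rewrite /theta0_coef /=; set f := (fun i : nat => _) in fs *.
rewrite -[X in X + _]single; set g := (fun i : nat => _).
have -> : tsum f = tsum (fun i => g i + (if i is j.+1 then f j.+1 else 0)).
  by apply: eq_tsum => -[|i]; rewrite /g /f ?addn0 ?addr0 ?add0r.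
have sub : has_sum (fun i => if i is j.+1 then f j.+1 else 0) (tsum (f \o S)).
  apply: (proj1 (@has_sum_inj _ _ _ S _ _ succn_inj _)).
    by move=> [|i] // /(_ i); rewrite eqxx.
  exact: (abs_has_sum (abs_summable_inj succn_inj fs)).
have fin : has_sum g (tsum g).
  by apply/abs_has_sum/(@abs_summable_finite _ _ _ [fset 0%N]%fset) => i; rewrite inE /g => /negbTE ->.
rewrite (has_sum_tsum (has_sumD fin sub)); congr (_ + _).
by apply: eq_tsum => i; rewrite /f /= addSnnS.
Qed.

Lemma chi_tsum m x : x != 0 ->
  abs_summable (fun k : int => if (`|k| <= m)%N then x ^ k else 0) /\
  chi m x = tsum (fun k : int => if (`|k| <= m)%N then x ^ k else 0).
Proof.
move=> x0; have one (k0 : int) : abs_summable (fun k : int => if k == k0 then x ^ k else 0) /\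
    tsum (fun k : int => if k == k0 then x ^ k else 0) = x ^ k0.
  split; last by rewrite (@tsum_single _ _ _ k0) ?eqxx // => i /negbTE ->.
  by apply: (@abs_summable_finite _ _ _ [fset k0]%fset) => k; rewrite inE => /negbTE ->.
elim: m => [|m [IHs IH]].
  have e (k : int) : (if k == 0 then x ^ k else 0) = if (`|k| <= 0)%N then x ^ k else 0.
    by rewrite leqn0 absz_eq0.
  have [s1 e1] := one 0; split; first exact: eq_abs_summable e s1.
  by rewrite -(eq_tsum e) e1.
have [s1 e1] := one m.+1; have [s2 e2] := one (- m.+1%:Z).
have e (k : int) : (if (`|k| <= m)%N then x ^ k else 0) +
    (if k == m.+1 then x ^ k else 0) + (if k == - m.+1%:Z then x ^ k else 0) =
    if (`|k| <= m.+1)%N then x ^ k else 0.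
  case: (leqP `|k|%N m) => h1.
    rewrite ifF; last by apply/negP => /eqP; lia.
    rewrite ifF; last by apply/negP => /eqP; lia.
    by rewrite leqW // !addr0.
  rewrite add0r; have [->|n1] := eqVneq k m.+1.
    have -> : (m.+1%:Z == - m.+1%:Z) = false by apply/negP => /eqP; lia.
    by rewrite absz_nat leqnn addr0.
  rewrite add0r; have [->|n2] := eqVneq k (- m.+1%:Z); first by rewrite abszN leqnn.
  rewrite ifF //; apply/negP => h; move/eqP: n1; move/eqP: n2; lia.
split.
  exact: eq_abs_summable e (abs_summableD (abs_summableD IHs s1) s2).
rewrite -(eq_tsum e) tsumD ?tsumD //; last exact: abs_summableD.
by rewrite -IH e1 e2 /=.
Qed.

Lemma theta0_expands : expands theta0 theta0_coef.
Proof.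
move=> x x0; have a0 : 0 < normc x by rewrite normc_gt0.
have [pn0 pn1] := andP p_norm01.
(* The pair [(k, i)] stands for the monomial [x^k] of [chi (`|k| + i)]; the
   family is dominated by a product because [tri (a + i) >= tri a + tri i]. *)
pose T (u : int * nat) := (-1) ^+ (`|u.1| + u.2) * p ^+ tri (`|u.1| + u.2) * x ^ u.1.
have Ts : abs_summable T.
  apply: (abs_summable_le _ (bounded_sums_prod _ _ (theta_bounded p_norm01 a0) tri_bounded1)).
  - move=> [k i]; rewrite /T normcM normcXz /= mulrAC; apply: ler_wpM2r.
      by rewrite exprz_ge0 // ltW.
    apply: le_trans (tri_norm_le _ _) _; apply: ler_wpM2r; first by rewrite exprn_ge0 // ltW.
    rewrite -[_ ^+ tri _]/(_ ^ (tri `|k|)%:Z).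
    by have /andP[h _] := tri_absz_ge k; apply: exprz_antimono p_norm01 h.
  - by move=> k; rewrite mulr_ge0 ?exprz_ge0 // ltW.
  - by move=> k; rewrite exprn_ge0 // ltW.
have rowE k : tsum (fun i => T (k, i)) = theta0_coef k * x ^ k.
  rewrite mulrC -tsumZ; first by apply: eq_tsum => i; rewrite mulrC.
  apply: eq_abs_summable (abs_summableZ (x ^ k)^-1 (abs_summable_row k Ts)) => i.
  by rewrite /T /= mulrC mulfK // expfz_neq0.
split; first by apply: eq_abs_summable (abs_summable_tsum Ts) => k /=; rewrite rowE.
rewrite triple_product // -(eq_tsum rowE) -tsum_pair //.
pose h (u : int * nat) := ((`|u.1| + u.2)%N, u.1).
have hI : injective h by move=> [k i] [l j] [h1 h2]; congr pair; lia.
pose T' (v : nat * int) := if (`|v.2| <= v.1)%N then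
  (-1) ^+ v.1 * p ^+ tri v.1 * x ^ v.2 else 0.
have T'h : T' \o h =1 T by move=> [k i]; rewrite /T' /T /= leq_addr.
have T'0 v : (forall u, v != h u) -> T' v = 0.
  case: v => m k; rewrite /T' /=; case: leqP => // km /(_ (k, (m - `|k|)%N)).
  by rewrite /h /= subnKC // eqxx.
have T's : abs_summable T'.
  by apply: (abs_summable_ext hI T'0); apply: eq_abs_summable Ts => u; rewrite -T'h.
have <- : tsum T' = tsum T.
  apply: has_sum_tsum; apply: (proj1 (has_sum_inj _ hI T'0)).
  by apply: has_sum_ext (abs_has_sum Ts) => u; rewrite T'h.
rewrite tsum_pair //; apply: eq_tsum => m /=.
have [cs ->] := chi_tsum m x0; rewrite -tsumZ //; apply: eq_tsum => k.
by rewrite /T' /=; case: ifP; rewrite ?mulr0.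
Qed.

End Jacobi.


(** * Theta functions *)

Section Theta.
Variable R : realType.
Notation C := R[i].

Lemma qpoch_neq0_head (x p : C) : normc p < 1 -> x != 1 -> normc (p * x) < 1 ->
  qpoch x p != 0.
Proof.
move=> p1 x1 px; apply: qpoch_neq0 => // -[|i].
  by rewrite expr0 mul1r subr_eq0 eq_sym.
rewrite subr_eq0; apply: contraTneq px => e.
have : normc (p ^+ i * (p * x)) <= normc (p * x).
  by rewrite normcM ler_piMl ?normc_ge0 // normcX exprn_ile1 ?normc_ge0 // ltW.
by rewrite mulrA -exprSr -e normc1 -leNgt.
Qed.

Lemma normc_lt1_neq1 (x : C) : normc x < 1 -> x != 1.
Proof. by apply: contraTneq => ->; rewrite normc1 ltxx. Qed.

Lemma qpoch_neq0_lt1 (x p : C) : normc p < 1 -> normc x < 1 -> qpoch x p != 0.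
Proof.
move=> p1 x1; apply: qpoch_neq0_head => //; first exact: normc_lt1_neq1.
by rewrite normcM mulr_ilt1 ?normc_ge0.
Qed.

Lemma eq_expands (H G : C -> C) (h : int -> C) :
  (forall x, x != 0 -> H x = G x) -> expands H h -> expands G h.
Proof. by move=> HG hH x x0; rewrite -HG //; apply: hH. Qed.

Variable p : C.
Hypotheses (p0 : p != 0) (p1 : normc p < 1).

Lemma jtheta_neq0 (x : C) : normc p < normc x < 1 -> jtheta x p != 0.
Proof.
move=> /andP[px x1]; have a0 := le_lt_trans (normc_ge0 p) px.
rewrite !mulf_neq0 ?qpoch_neq0_lt1 //.
by rewrite normcM normcV ltr_pdivrMr // mul1r.
Qed.

Lemma jtheta_theta0 (x : C) : jtheta x p = (1 - x) * theta0 p x.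
Proof. by rewrite /jtheta /theta0 (qpoch_rec x p1) !mulrA. Qed.

Lemma theta0_one : theta0 p 1 = qpoch p p ^+ 3.
Proof. by rewrite /theta0 mulr1 divr1 !exprS expr0; ring. Qed.

Lemma jtheta_one : jtheta 1 p = 0.
Proof. by rewrite jtheta_theta0 subrr mul0r. Qed.

Lemma jtheta_shift (x : C) : x != 0 -> jtheta (p * x) p = - x^-1 * jtheta x p.
Proof.
move=> x0; rewrite /jtheta (qpoch_rec x p1).
have -> : p / (p * x) = x^-1 by field; rewrite x0 p0.
rewrite (qpoch_rec x^-1 p1).
move: (qpoch _ _) (qpoch _ _) (qpoch _ _) => a b c; by field.
Qed.

(** The Laurent coefficients of [jtheta]. *)
Definition theta_coef (n : int) : C := (-1) ^ n * p ^ binz2 n.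

Lemma theta_coef0 : theta_coef 0 = 1.
Proof. by rewrite /theta_coef binz2_0 !expr0z mulr1. Qed.

Lemma theta_coefS n : theta_coef (n + 1) = - p ^ n * theta_coef n.
Proof.
have N1 : (-1 : C) != 0 by rewrite oppr_eq0 oner_eq0.
rewrite /theta_coef binz2S (expfzDr _ _ p0) (expfzDr _ _ N1) expr1z.
move: (_ ^ _) (_ ^ _) (_ ^ _) => a b c; ring.
Qed.

Lemma degree1_coef (H : C -> C) (h : int -> C) (u : C) : u != 0 ->
  expands H h -> (forall x, x != 0 -> H (p * x) = - (u * x)^-1 * H x) ->
  forall n, h n = h 0 * (theta_coef n * u ^ n).
Proof.
move=> u0 hH Hp.
have rec n : h (n + 1) = - u * p ^ n * h n.
  have := expands_unique (expands_dilate p0 hH) (eq_expands _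
    (expandsZ (- u^-1) (expands_shift (-1) hH))) n.
  rewrite opprK => e; rewrite -mulrA [p ^ n * _]mulrC e; first by field.
  by move=> x x0; rewrite Hp // -[x ^ (-1)]/(x^-1); field; rewrite x0 u0.
apply: (@recurrence_unique _ (fun n => - u * p ^ n)) => //.
- by move=> n; rewrite mulf_neq0 ?oppr_eq0 ?expfz_neq0.
- by move=> n; rewrite theta_coefS (expfzDr _ _ u0) expr1z; ring.
- by rewrite theta_coef0 expr0z mulr1.
Qed.

Lemma jtheta_expands : expands (fun x => jtheta x p) theta_coef.
Proof.
have e0 := theta0_expands p0 p1.
have e : expands (fun x => jtheta x p)
    (fun n => theta0_coef p n + -1 * theta0_coef p (n - 1)).
  apply: eq_expands (expandsD e0 (expandsZ (-1) (expands_shift 1 e0))) => x x0.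
  by rewrite jtheta_theta0 expr1z; ring.
have := degree1_coef (oner_neq0 _) e.
have -> : theta0_coef p 0 + -1 * theta0_coef p (0 - 1) = 1.
  have -> : theta0_coef p (0 - 1) = theta0_coef p 1 by [].
  by rewrite (theta0_coefS p0 p1 0) mulN1r addrK expr0 mul1r.
move=> h; have {}h : (fun n => theta0_coef p n + -1 * theta0_coef p (n - 1)) = theta_coef.
  apply: funext => n; rewrite h ?mul1r ?exp1rz ?mulr1 // => x x0.
  by rewrite jtheta_shift // mul1r.
by rewrite -h.
Qed.

Lemma laurent_jtheta : laurent (fun x => jtheta x p).
Proof. by exists theta_coef; apply: jtheta_expands. Qed.

Lemma laurent_jthetaM (u : C) : u != 0 -> laurent (fun x => jtheta (u * x) p).
Proof. by move=> u0; apply: (laurent_dilate u0 laurent_jtheta). Qed.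

(** Theta functions of degree one form a line. *)
Lemma degree1 (H : C -> C) (u : C) : u != 0 -> laurent H ->
  (forall x, x != 0 -> H (p * x) = - (u * x)^-1 * H x) ->
  exists k, forall x, x != 0 -> H x = k * jtheta (u * x) p.
Proof.
move=> u0 [h hH] Hp; exists (h 0) => x x0; have [hs ->] := hH _ x0.
have [js ->] := jtheta_expands (mulf_neq0 u0 x0).
rewrite -tsumZ //; apply: eq_tsum => n.
by rewrite (degree1_coef u0 hH Hp) expfzMl !mulrA.
Qed.

End Theta.

Lemma int_half (n : int) : exists m, n = 2 * m \/ n = 2 * m + 1.
Proof. by exists (n %/ 2)%Z; lia. Qed.

Lemma even_part0 (R : realType) (h : int -> R[i]) (x : R[i]) : x != 0 ->
  abs_summable (fun n => h n * x ^ n) -> abs_summable (fun n => h n * (- x) ^ n) ->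
  tsum (fun n => h n * x ^ n) = 0 -> tsum (fun n => h n * (- x) ^ n) = 0 ->
  tsum (fun n => h (2 * n) * x ^ (2 * n)) = 0.
Proof.
move=> x0 s1 s2 z1 z2; have := even_part x0 s1 s2.
rewrite z1 z2 addr0 => /esym/eqP; rewrite mulf_eq0 pnatr_eq0 /= => /eqP; exact.
Qed.

Section Degree2.
Variable R : realType.
Notation C := R[i].
Variable q : C.
Hypotheses (q0 : q != 0) (q1 : normc q < 1).

Let q4 : C := q ^+ 4.

(** A theta function of degree two vanishing at [1] and [-1] is zero: its even
    and odd parts are multiples of a theta function of nome [q ^+ 4], whose
    value at [1] does not vanish. *)
Lemma degree2_eq0 (H : C -> C) (u : C) : normc q ^+ 2 < normc u < 1 ->
  laurent H ->
  (forall x, x != 0 -> H (q ^+ 2 * x) = (u * x ^+ 2)^-1 * H x) ->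
  H 1 = 0 -> H (-1) = 0 -> forall x, x != 0 -> H x = 0.
Proof.
move=> /andP[qu u1] [h hH] Hq H1 HN1.
have nq : 0 < normc q by rewrite normc_gt0.
have u0 : u != 0 by rewrite -normc_gt0; apply: lt_trans qu; rewrite exprn_gt0.
have q40 : q4 != 0 by apply: expf_neq0.
have q41 : normc q4 < 1 by rewrite normcX exprn_ilt1 ?normc_ge0.
have q20 : q ^+ 2 != 0 by apply: expf_neq0.
have rec n : h (n + 2) = u * (q ^+ 2) ^ n * h n.
  have := expands_unique (expands_dilate q20 hH) (eq_expands _
    (expandsZ u^-1 (expands_shift (-2) hH))) n.
  rewrite opprK => e; rewrite -mulrA [(q ^+ 2) ^ n * _]mulrC e; first by field.
  by move=> x x0; rewrite Hq // -[x ^ (-2)]/((x ^+ 2)^-1); field; rewrite x0 u0.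
(* Either parity class of the coefficients obeys the recurrence of a theta
   function of nome [q^4]. *)
have coef (v : C) (a : int -> C) : v != 0 -> normc q4 < normc v < 1 ->
    (forall n, a (n + 1) = v * q4 ^ n * a n) -> abs_summable a -> tsum a = 0 ->
    forall n, a n = 0.
  move=> v0 vA ha as_ a00; have vN0 : - v != 0 by rewrite oppr_eq0.
  have aE : forall n, a n = a 0 * (theta_coef q4 n * (- v) ^ n).
    apply: (@recurrence_unique _ (fun n => v * q4 ^ n)) => //.
    - by move=> n; rewrite mulf_neq0 ?expfz_neq0.
    - by move=> n; rewrite (theta_coefS q40) (expfzDr _ _ vN0) expr1z; ring.
    - by rewrite theta_coef0 expr0z mulr1.
  have [js jE] := jtheta_expands q40 q41 vN0.
  have : a 0 * jtheta (- v) q4 = 0.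
    by rewrite jE -tsumZ // -[RHS]a00; apply: eq_tsum => n; rewrite -aE.
  move/eqP; rewrite mulf_eq0 => /orP[/eqP a0E n|]; first by rewrite aE a0E mul0r.
  by rewrite (negbTE (jtheta_neq0 q41 _)) // normcN.
have [hs h1] := hH _ (oner_neq0 _).
have N1 : (-1 : C) != 0 by rewrite oppr_eq0 oner_eq0.
have [hsN hN1] := hH _ N1.
have hs1 : abs_summable h.
  by apply: eq_abs_summable hs => n; rewrite exp1rz mulr1.
have i2 : injective (fun n : int => 2 * n + 1) by move=> m n /addIr /mulfI ->.
have es := abs_summable_inj mul2z_inj hs1; have os := abs_summable_inj i2 hs1.
have e0 : tsum (fun n => h (2 * n)) = 0.
  rewrite -[RHS](even_part0 (oner_neq0 _) hs hsN (etrans (esym h1) H1)).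
    by apply: eq_tsum => n; rewrite exp1rz mulr1.
  exact: (etrans (esym hN1) HN1).
have o0 : tsum (fun n => h (2 * n + 1)) = 0.
  pose g n := h (n + 1).
  have gs : abs_summable (fun n => g n * 1 ^ n).
    apply: eq_abs_summable (abs_summable_inj (bij_inj (addz_bij 1)) hs1) => n.
    by rewrite exp1rz mulr1.
  have gE : (fun n => g n * (-1) ^ n) =1 (fun n => -1 * (h (n + 1) * (-1) ^ (n + 1))).
    by move=> n; rewrite /g expfzDr // expr1z; ring.
  have gs' := abs_summable_inj (bij_inj (addz_bij 1)) hsN.
  have gsN : abs_summable (fun n => g n * (-1) ^ n).
    by apply: eq_abs_summable (abs_summableZ (-1) gs') => n; rewrite gE.
  have z1 : tsum (fun n => g n * 1 ^ n) = 0.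
    apply: (etrans _ (etrans (esym h1) H1)).
    rewrite (tsum_bij (addz_bij 1) hs); apply: eq_tsum => n.
    by rewrite !exp1rz.
  have zN1 : tsum (fun n => g n * (-1) ^ n) = 0.
    rewrite (eq_tsum gE) (tsumZ _ gs') -(tsum_bij (addz_bij 1) hsN).
    by apply/eqP; rewrite mulf_eq0; apply/orP; right; apply/eqP/(etrans (esym hN1) HN1).
  rewrite -[RHS](even_part0 (oner_neq0 _) gs gsN z1 zN1).
  by apply: eq_tsum => n; rewrite exp1rz mulr1.
have q4E n : (q ^+ 2) ^ (2 * n) = q4 ^ n.
  by rewrite -exprz_exp -[(q ^+ 2) ^ 2]/((q ^+ 2) ^+ 2) -exprM.
have hz n : h n = 0.
  have even : forall n, h (2 * n) = 0.
    apply: (@coef u) => //.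
      rewrite u1 andbT; apply: le_lt_trans qu.
      by rewrite normcX; apply: ler_wiXn2l => //; apply: ltW.
    by move=> k; rewrite mulrDr rec q4E.
  have odd : forall n, h (2 * n + 1) = 0.
    apply: (@coef (u * q ^+ 2)) => //.
    - exact: mulf_neq0.
    - have -> : normc q4 = normc q ^+ 2 * normc q ^+ 2 by rewrite normcX -exprD.
      rewrite normcM normcX ltr_pM2r ?exprn_gt0 // qu /=.
      by rewrite mulr_ilt1 ?normc_ge0 ?exprn_ge0 ?normc_ge0 // exprn_ilt1 ?normc_ge0.
    - move=> k; have -> : 2 * (k + 1) + 1 = 2 * k + 1 + 2 by ring.
      by rewrite rec expfzDr // expr1z q4E; ring.
  by have [m [->|->]] := int_half n.
move=> x x0; have [_ ->] := hH _ x0.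
by rewrite -[RHS](@tsum0 R int); apply: eq_tsum => n; rewrite hz mul0r.
Qed.

End Degree2.

(** * Appell sums *)

Section Appell.
Variable R : realType.
Notation C := R[i].
Variable p : C.
Hypotheses (p0 : p != 0) (p1 : normc p < 1).

Let np0 : 0 < normc p. Proof. by rewrite normc_gt0. Qed.

(** [jtheta x p / (1 - p ^ N * x)], as a function without singularities. *)
Definition kern (N : int) (x : C) : C :=
  theta_coef p N * x ^ N * theta0 p (p ^ N * x).

Lemma jtheta_shiftz (N : int) (x : C) : x != 0 ->
  theta_coef p N * x ^ N * jtheta (p ^ N * x) p = jtheta x p.
Proof.
move=> x0; move: N; apply: int_step_ind => [|N].
  by rewrite theta_coef0 !expr0z !mul1r.
suff -> : theta_coef p (N + 1) * x ^ (N + 1) * jtheta (p ^ (N + 1) * x) p =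
    theta_coef p N * x ^ N * jtheta (p ^ N * x) p by [].
have pN : p ^ N != 0 by rewrite expfz_neq0.
rewrite (expfzDr _ _ p0) (expfzDr _ _ x0) !expr1z (theta_coefS p0) [p ^ N * p]mulrC.
rewrite -[p * _ * x]mulrA (jtheta_shift p0 p1) ?mulf_neq0 //.
by move: (jtheta _ _) (theta_coef _ _) (x ^ N) => a b c; field; rewrite x0 pN.
Qed.

Lemma kernE (N : int) (x : C) : x != 0 ->
  (1 - p ^ N * x) * kern N x = jtheta x p.
Proof.
move=> x0; rewrite -(jtheta_shiftz N x0) (jtheta_theta0 p1) /kern.
move: (theta0 _ _) => a; ring.
Qed.

Lemma kern_lin (N : int) (x : C) : x != 0 ->
  p ^ N * x * kern N x = kern N x - jtheta x p.
Proof. by move=> x0; rewrite -(kernE N x0); ring. Qed.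

Lemma kern_shift (N : int) (x : C) : x != 0 ->
  kern N (p * x) = - x^-1 * kern (N + 1) x.
Proof.
move=> x0; rewrite /kern (theta_coefS p0) (expfzDr _ _ p0) (expfzDr _ _ x0) expfzMl.
rewrite !expr1z [p ^ N * (p * x)]mulrA; move: (theta0 _ _) (theta_coef _ _) => a b.
by move: (p ^ N) (x ^ N) => c d; field.
Qed.

Lemma kern0_one : kern 0 1 = qpoch p p ^+ 3.
Proof. by rewrite /kern theta_coef0 !expr0z !mul1r theta0_one. Qed.

Lemma expz_neq1 (N : int) : N != 0 -> p ^ N != 1.
Proof.
case: N => [[//|n]|n] _; [|rewrite -[p ^ _]/((p ^+ n.+1)^-1) invr_eq1];
  by have := one_sub_exp_neq0 p1 (ltn0Sn n); rewrite subr_eq0 eq_sym.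
Qed.

Lemma kern_one (N : int) : N != 0 -> kern N 1 = 0.
Proof.
move=> N0; apply: (mulfI (_ : 1 - p ^ N * 1 != 0)).
  by rewrite mulr1 subr_eq0 eq_sym expz_neq1.
by rewrite (kernE _ (oner_neq0 _)) (jtheta_one p1) mulr0.
Qed.

(** The Laurent coefficients of [kern N]. *)
Definition kern_coef (N n : int) : C :=
  theta_coef p N * (theta0_coef p (n - N) * (p ^ N) ^ (n - N)).

Lemma kern_expands N : expands (kern N) (kern_coef N).
Proof.
have pN : p ^ N != 0 by rewrite expfz_neq0.
have := expandsZ (theta_coef p N)
  (expands_shift N (expands_dilate pN (theta0_expands p0 p1))).
by apply: eq_expands => x x0; rewrite /kern mulrA.
Qed.

(** How much smaller the coefficients of [kern N] are for negative [N]; the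
    weights of an Appell sum may be larger there by the inverse factor. *)
Definition weight (N : int) : R := if 0 <= N then 1 else normc p ^ (- N).

Lemma weight_ge0 N : 0 <= weight N.
Proof. by rewrite /weight; case: ifP => _ //; rewrite exprz_ge0 // ltW. Qed.

Lemma weight_le1 N : weight N <= 1.
Proof.
rewrite /weight; case: ifP => // /negbT; rewrite -ltNge => N0.
have -> : 1 = normc p ^ (0 : int) by [].
by apply: exprz_antimono; [rewrite np0|lia].
Qed.

(** A common majorant for the coefficients of the [kern N]. *)
Definition kern_majorant (n : int) : R := normc p ^ binz2 n * (1 + normc p ^ n).

(** The coefficients of [kern N] are dominated uniformly in [N], because
    [binz2 N + N * k + binz2 k = binz2 (N + k)]. *)
Lemma kern_coef_bound : exists2 K : R, 0 <= K & forall N n,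
  normc (kern_coef N n) <= K * weight N * kern_majorant n.
Proof.
have [K K0 hK] := theta0_coef_bound p0 p1; exists K => // N n.
set k := n - N; have nE : n = N + k by rewrite /k; ring.
have p01 : 0 < normc p < 1 by rewrite np0.
have pu : normc p != 0 by rewrite gt_eqF.
have h : normc (kern_coef N n) <= K * normc p ^ (binz2 N + N * k + (tri `|k|)%:Z).
  rewrite /kern_coef /theta_coef -/k !normcM !normcXz normcN normc1 exp1rz mul1r.
  rewrite (expfzDr _ _ pu) (expfzDr _ _ pu) (exprz_exp (normc p) N k).
  have P1 : 0 <= normc p ^ binz2 N by rewrite exprz_ge0 // ltW.
  have P2 : 0 <= normc p ^ (N * k) by rewrite exprz_ge0 // ltW.
  have := hK k; rewrite -[_ ^+ tri _]/(_ ^ (tri `|k|)%:Z) => h.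
  have := ler_wpM2r P2 (ler_wpM2l P1 h); congr (_ <= _); ring.
have /andP[t1 t2] := tri_absz_ge k.
apply: le_trans h _; rewrite -mulrA; apply: ler_wpM2l => //.
have E m : 0 <= normc p ^ m by rewrite exprz_ge0 // ltW.
rewrite /weight /kern_majorant; case: ifP => _.
  apply: (@le_trans _ _ (normc p ^ binz2 n)).
    by apply: exprz_antimono p01 _; rewrite nE binz2D; lia.
  by rewrite mul1r ler_peMr // lerDl.
apply: (@le_trans _ _ (normc p ^ (- N) * (normc p ^ binz2 n * normc p ^ n))).
  rewrite -(expfzDr _ _ pu) -(expfzDr _ _ pu).
  by apply: exprz_antimono p01 _; rewrite nE binz2D; lia.
by apply: ler_wpM2l => //; apply: ler_wpM2l => //; rewrite lerDr.
Qed.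

Lemma kern_majorant_bounded (x : C) : x != 0 ->
  bounded_sums (fun n => kern_majorant n * normc x ^ n).
Proof.
move=> x0; have p01 : 0 < normc p < 1 by rewrite np0.
have nx : 0 < normc x by rewrite normc_gt0.
apply: bounded_sums_le (bounded_sumsD (theta_bounded p01 nx)
  (theta_bounded p01 (mulr_gt0 np0 nx))) => n.
by rewrite /kern_majorant expfzMl; move: (_ ^ _) (_ ^ _) (_ ^ _) => a b c; lra.
Qed.

#[local] Opaque theta0 kern jtheta qpoch.

Section Sums.
Variables (I : choiceType) (w : I -> C) (nu : I -> int).

(** The weights for which the Appell sum converges absolutely. *)
Definition admissible : Prop := bounded_sums (fun i => normc (w i) * weight (nu i)).

(** The Appell sum with weights [w], multiplied by [jtheta x p]: see
    [appell_quotient]. *)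
Definition appell (x : C) : C := tsum (fun i => w i * kern (nu i) x).

Hypothesis w_adm : admissible.

Lemma appell_double x : x != 0 ->
  abs_summable (fun u : I * int => w u.1 * kern_coef (nu u.1) u.2 * x ^ u.2).
Proof.
move=> x0; have [K K0 hK] := kern_coef_bound.
have nx : 0 < normc x by rewrite normc_gt0.
have g0 n : 0 <= kern_majorant n * normc x ^ n.
  by rewrite /kern_majorant !mulr_ge0 ?addr_ge0 ?exprz_ge0 // ltW.
have w0 i : 0 <= normc (w i) * weight (nu i).
  by rewrite mulr_ge0 ?normc_ge0 ?weight_ge0.
apply: (abs_summable_le _ (bounded_sumsZ K0 (bounded_sums_prod w0 g0 w_adm
  (kern_majorant_bounded x0)))) => -[i n] /=.
have P1 : 0 <= normc x ^ n by rewrite exprz_ge0 // ltW.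
rewrite [normc (_ * x ^ n)]normcM [normc (w i * _)]normcM (normcXz x).
have := ler_wpM2r P1 (ler_wpM2l (normc_ge0 (w i)) (hK (nu i) n)).
move=> h; apply: le_trans h _; rewrite le_eqVlt; apply/orP; left; apply/eqP; ring.
Qed.

Lemma appell_row x i : x != 0 ->
  tsum (fun n => w i * kern_coef (nu i) n * x ^ n) = w i * kern (nu i) x.
Proof.
move=> x0; have [ks ->] := kern_expands (nu i) x0.
by rewrite -tsumZ //; apply: eq_tsum => n; rewrite mulrA.
Qed.

Lemma appell_summable x : x != 0 -> abs_summable (fun i => w i * kern (nu i) x).
Proof.
move=> x0; apply: eq_abs_summable (abs_summable_tsum (appell_double x0)) => i /=.
exact: appell_row.
Qed.

Lemma laurent_appell : laurent appell.
Proof.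
exists (fun n => tsum (fun i => w i * kern_coef (nu i) n)) => x x0.
pose sw (u : int * I) := (u.2, u.1).
have swB : bijective sw by exists (fun u => (u.2, u.1)) => -[].
have ds := appell_double x0; have ds' := abs_summable_inj (bij_inj swB) ds.
have d1 := appell_double (oner_neq0 _).
have col n : tsum (fun i => w i * kern_coef (nu i) n * x ^ n) =
    tsum (fun i => w i * kern_coef (nu i) n) * x ^ n.
  rewrite mulrC -tsumZ; first by apply: eq_tsum => i; rewrite mulrC.
  apply: eq_abs_summable (abs_summable_row n (abs_summable_inj (bij_inj swB) d1)) => i /=.
  by rewrite exp1rz mulr1.
split; first by apply: eq_abs_summable (abs_summable_tsum ds') => n /=; rewrite col.
rewrite /appell -(eq_tsum (fun i => appell_row i x0)) -(tsum_pair ds).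
rewrite (tsum_bij swB ds) (tsum_pair ds'); apply: eq_tsum => n /=; exact: col.
Qed.

Lemma one_sub_neq0 x N : jtheta x p != 0 -> x != 0 -> 1 - p ^ N * x != 0.
Proof.
move=> j0 x0; apply: contraNneq j0 => e.
by rewrite -(kernE N x0) e mul0r.
Qed.

Lemma appell_quotient x : x != 0 -> jtheta x p != 0 ->
  abs_summable (fun i => w i / (1 - p ^ nu i * x)) /\
  appell x = jtheta x p * tsum (fun i => w i / (1 - p ^ nu i * x)).
Proof.
move=> x0 j0.
have e i : w i * kern (nu i) x = jtheta x p * (w i / (1 - p ^ nu i * x)).
  have d0 := one_sub_neq0 (nu i) j0 x0; rewrite -(kernE (nu i) x0).
  by move: (kern _ _) => k; field.
have s := appell_summable x0.
have s' : abs_summable (fun i => w i / (1 - p ^ nu i * x)).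
  apply: eq_abs_summable (abs_summableZ (jtheta x p)^-1 s) => i.
  by rewrite e mulKf.
by split=> //; rewrite -tsumZ //; apply: eq_tsum.
Qed.

Lemma appell_shift x : x != 0 ->
  abs_summable (fun i => w i * kern (nu i + 1) x) /\
  appell (p * x) = - x^-1 * tsum (fun i => w i * kern (nu i + 1) x).
Proof.
move=> x0; have s := appell_summable (mulf_neq0 p0 x0).
have e i : w i * kern (nu i) (p * x) = - x^-1 * (w i * kern (nu i + 1) x).
  by rewrite kern_shift // mulrCA.
have s' : abs_summable (fun i => w i * kern (nu i + 1) x).
  apply: eq_abs_summable (abs_summableZ (- x) s) => i.
  by rewrite e; move: (w i * kern _ x) => k; field.
by split=> //; rewrite -tsumZ //; apply: eq_tsum.
Qed.

Lemma appell_shift2 x : x != 0 ->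
  abs_summable (fun i => w i * kern (nu i + 2) x) /\
  appell (p ^+ 2 * x) = (p * x ^+ 2)^-1 * tsum (fun i => w i * kern (nu i + 2) x).
Proof.
move=> x0; have px0 := mulf_neq0 p0 x0.
have s := appell_summable (mulf_neq0 p0 px0).
have e i : w i * kern (nu i) (p * (p * x)) =
    (p * x ^+ 2)^-1 * (w i * kern (nu i + 2) x).
  rewrite !kern_shift // -addrA; move: (kern _ _) => k; field.
  by rewrite x0 p0.
have c0 : p * x ^+ 2 != 0 by rewrite mulf_neq0 ?expf_neq0.
have s' : abs_summable (fun i => w i * kern (nu i + 2) x).
  apply: eq_abs_summable (abs_summableZ (p * x ^+ 2) s) => i.
  by rewrite e; move: (w i * kern _ x) => k; exact: mulVKf.
by split=> //; rewrite -tsumZ // expr2 -mulrA; apply: eq_tsum.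
Qed.

End Sums.

End Appell.

(** * The Kronecker double sum and the triple sum as Appell sums *)

Lemma appellE (R : realType) (p : R[i]) (I : choiceType) (w : I -> R[i])
    (nu : I -> int) (x : R[i]) :
  appell p w nu x = tsum (fun i => w i * kern p (nu i) x).
Proof. by []. Qed.

(* Unification must not unfold these functions down to limits of products. *)
Opaque theta0 kern appell jtheta qpoch.

(** The two-sided geometric majorant: ratio [a] on nonnegative indices, [b] on
    negative ones. *)
Definition geo (R : realType) (a b : R) (s : int) : R :=
  match s with Posz n => a ^+ n | Negz n => b ^+ n.+1 end.

Lemma geo_ge0 (R : realType) (a b : R) s : 0 <= a -> 0 <= b -> 0 <= geo a b s.
Proof. by move=> a0 b0; case: s => n; apply: exprn_ge0. Qed.

Lemma geo_bounded (R : realType) (a b : R) : 0 <= a < 1 -> 0 <= b < 1 ->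
  bounded_sums (geo a b).
Proof.
move=> a01 b01; have [a0 _] := andP a01; have [b0 _] := andP b01.
apply: bounded_sums_int => [s||]; first exact: geo_ge0.
  exact: bounded_sums_geom.
exact: bounded_sums_inj succn_inj (bounded_sums_geom b01).
Qed.

Lemma geo_neg (R : realType) (a b : R) (s : int) : s < 0 -> geo a b s = b ^ (- s).
Proof. by case: s => n //; rewrite NegzE opprK. Qed.

Lemma geo_pos (R : realType) (a b : R) (s : int) : 0 <= s -> geo a b s = a ^ s.
Proof. by case: s. Qed.

Section Geometric.
Variable R : realType.
Notation C := R[i].

Lemma geom_recurrence (D : pred int) (u d : C) : u != 0 ->
  abs_summable (fun r : int => if D r then u ^ r else 0) ->
  (forall r : int, (D r)%:R - (D (r - 1))%:R = (if r == 0 then d else 0) :> C) ->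
  (1 - u) * tsum (fun r : int => if D r then u ^ r else 0) = d.
Proof.
move=> u0; set f := (fun r : int => _) => fs hD.
have fs1 := abs_summable_inj (bij_inj (addz_bij (-1))) fs.
rewrite mulrBl mul1r {2}(tsum_bij (addz_bij (-1)) fs) -(tsumZ _ fs1) -tsumB //; last first.
  exact: abs_summableZ.
have e r : f r - u * (f \o (fun n => n + -1)) r = if r == 0 then d else 0.
  transitivity (((D r)%:R - (D (r - 1))%:R) * u ^ r); last first.
    by rewrite hD; case: eqP => [->|_]; rewrite ?expr0z ?mulr1 ?mul0r.
  have ur : u ^ r = u * u ^ (r - 1).
    by rewrite -[in LHS](subrK 1 r) (expfzDr _ _ u0) expr1z mulrC.
  by rewrite /f /= ur; case: (D r); case: (D (r - 1)) => /=; ring.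
rewrite (eq_tsum e) (@tsum_single _ _ _ 0) ?eqxx // => r /negbTE -> //.
Qed.

Lemma geom_nonneg (c u : C) : u != 0 -> normc u < 1 ->
  tsum (fun r : int => if 0 <= r then c * u ^ r else 0) = c / (1 - u).
Proof.
move=> u0 u1; have d0 : 1 - u != 0 by rewrite subr_eq0 eq_sym normc_lt1_neq1.
have fs : abs_summable (fun r : int => if 0 <= r then u ^ r else 0).
  apply: (@abs_summable_le _ _ _ (geo (normc u) 0)) => [r|].
    case: ifP => [r0|/negbT]; first by rewrite geo_pos // normcXz.
    by rewrite -ltNge normc0 => /geo_neg ->; rewrite exprz_ge0.
  by apply: geo_bounded; rewrite ?normc_ge0 ?u1 ?lexx ?ltr01.
transitivity (c * tsum (fun r : int => if 0 <= r then u ^ r else 0)).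
  by rewrite -tsumZ //; apply: eq_tsum => r; case: ifP; rewrite ?mulr0.
congr (_ * _); apply: (mulfI d0); rewrite divff //.
apply: (geom_recurrence (D := fun r => 0 <= r)) => // r.
case: eqP => [->|r0] /=; first by rewrite subr0.
suff -> : (0 <= r - 1) = (0 <= r) by rewrite subrr.
by apply/idP/idP; lia.
Qed.

Lemma geom_neg (c u : C) : 1 < normc u ->
  tsum (fun r : int => if r < 0 then c * u ^ r else 0) = - (c / (1 - u)).
Proof.
move=> u1; have nu0 : 0 < normc u by apply: lt_trans u1.
have u0 : u != 0 by rewrite -normc_gt0.
have d0 : 1 - u != 0.
  by rewrite subr_eq0; apply: contraTneq u1 => <-; rewrite normc1 ltxx.
have fs : abs_summable (fun r : int => if r < 0 then u ^ r else 0).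
  apply: (@abs_summable_le _ _ _ (geo 0 (normc u)^-1)) => [r|].
    case: ifP => [r0|/negbT]; first by rewrite geo_neg // normcXz exprz_inv opprK.
    by rewrite -leNgt normc0 => /geo_pos ->; rewrite exprz_ge0.
  by apply: geo_bounded; rewrite ?lexx ?ltr01 // invr_ge0 ltW //= invf_lt1.
transitivity (c * tsum (fun r : int => if r < 0 then u ^ r else 0)).
  by rewrite -tsumZ //; apply: eq_tsum => r; case: ifP; rewrite ?mulr0.
rewrite -mulrN; congr (_ * _); apply: (mulfI d0); rewrite mulrN divff //.
apply: (geom_recurrence (D := fun r => r < 0)) => // r.
case: eqP => [->|r0] /=; first by rewrite sub0r.
suff -> : (r - 1 < 0) = (r < 0) by rewrite subrr.
by apply/idP/idP; lia.
Qed.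

End Geometric.

Section Kronecker.
Variable R : realType.
Notation C := R[i].
Variable q : C.
Hypotheses (q0 : q != 0) (q1 : normc q < 1).

Let nq0 : 0 < normc q. Proof. by rewrite normc_gt0. Qed.
Let nq01 : 0 < normc q < 1. Proof. by rewrite nq0. Qed.

(** The fundamental annulus of the shift [x -> q * x]. *)
Definition annulus (x : C) : Prop := normc q < normc x < 1.

Lemma annulus_neq0 x : annulus x -> x != 0.
Proof. by move=> /andP[h _]; rewrite -normc_gt0 (lt_trans nq0). Qed.

(** The majorant of the powers of a point of the annulus. *)
Definition ageo (x : C) : int -> R := geo (normc x) (normc q / normc x).

Lemma normc_pow_lt1 x (n : int) : annulus x -> 0 <= n -> normc (q ^ n * x) < 1.
Proof.
move=> /andP[_ x1] n0; apply: le_lt_trans x1.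
rewrite normcM normcXz ler_piMl ?normc_ge0 // -(expr0z (normc q)).
exact: exprz_antimono nq01 n0.
Qed.

Lemma normc_pow_gt1 x (n : int) : annulus x -> n < 0 -> 1 < normc (q ^ n * x).
Proof.
move=> /andP[qx _] n0; rewrite normcM normcXz.
have nm : n <= -1 by lia.
apply: (@lt_le_trans _ _ (normc q ^ (-1) * normc x)).
  by rewrite -[normc q ^ (-1)]/((normc q)^-1) mulrC ltr_pdivlMr // mul1r.
by apply: ler_wpM2r; rewrite ?normc_ge0 //; apply: exprz_antimono nq01 nm.
Qed.

Lemma ageo_ge0 x s : 0 <= ageo x s.
Proof. by apply: geo_ge0; rewrite ?divr_ge0 ?normc_ge0. Qed.

Lemma ageo_bounded x : annulus x -> bounded_sums (ageo x).
Proof.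
move=> xA; have /andP[h1 h2] := xA; have x0 := annulus_neq0 xA.
have nx : 0 < normc x by rewrite normc_gt0.
apply: geo_bounded; first by rewrite normc_ge0.
by rewrite divr_ge0 ?normc_ge0 //= ltr_pdivrMr // mul1r.
Qed.

Lemma ageo_neg x (s : int) : s < 0 -> ageo x s = normc q ^ (- s) * normc x ^ s.
Proof.
by move=> s0; rewrite /ageo geo_neg // expfzMl exprz_inv opprK.
Qed.

Lemma kron_admissible y : annulus y -> admissible q (fun N : int => y ^ N) id.
Proof.
move=> yA; apply: bounded_sums_le (ageo_bounded yA) => N.
rewrite /weight normcXz; case: ifP => [N0|/negbT]; first by rewrite mulr1 /ageo geo_pos.
by rewrite -ltNge => N0; rewrite ageo_neg // mulrC.
Qed.

(** The Kronecker sum [sum_N y^N / (1 - q^N x)], multiplied by [jtheta x q]. *)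
Definition kron (y x : C) : C := appell q (fun N : int => y ^ N) id x.

Lemma kron_jtheta y x : annulus y -> x != 0 ->
  kron y x = qpoch q q ^+ 3 * jtheta (y * x) q / jtheta y q.
Proof.
move=> yA x0; have y0 := annulus_neq0 yA; have adm := kron_admissible yA.
have jy0 : jtheta y q != 0 := jtheta_neq0 q1 yA.
have [t t0|k hk] := degree1 q0 q1 y0 (laurent_appell q0 q1 adm).
  have [s ->] := appell_shift q0 q1 adm t0.
  rewrite appellE (tsum_bij (addz_bij 1) (appell_summable q0 q1 adm t0)) /=.
  have -> : tsum (fun N : int => y ^ (N + 1) * kern q (N + 1) t) =
      y * tsum (fun N : int => y ^ N * kern q (N + 1) t).
    by rewrite -(tsumZ _ s); apply: eq_tsum => N; rewrite (expfzDr _ _ y0) expr1z; ring.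
  by move: (tsum _) => S; field; rewrite y0 t0.
have := hk 1 (oner_neq0 _); rewrite mulr1 appellE (@tsum_single _ _ _ 0) => [|N N0].
  rewrite expr0z mul1r kern0_one // => ->; rewrite -[kron y x]/(appell _ _ _ _) hk //.
  by move: (jtheta _ _) (jtheta _ _) jy0 => a b b0; field.
by rewrite kern_one // mulr0.
Qed.

(** The sign of the [(s, t)] term: a geometric series over [r >= 0] and one over
    [r < 0] have opposite sums as rational functions. *)
Definition sgn2 (s t : int) : C :=
  if (0 <= s) && (0 <= t) then 1 else if (s < 0) && (t < 0) then -1 else 0.

Lemma sgn2S (s t : int) :
  sgn2 (s + 1) (t + 1) = sgn2 s t + (s == -1)%:R + (t == -1)%:R.
Proof.
have cases (r : int) : r < -1 \/ r = -1 \/ 0 <= r by lia.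
have neg (r : int) : r < -1 -> ((0 <= r + 1) = false) * ((r + 1 < 0) = true) *
    ((0 <= r) = false) * ((r < 0) = true) * ((r == -1) = false).
  by move=> h; do !split; apply/idP/idP; lia.
have pos (r : int) : 0 <= r -> ((0 <= r + 1) = true) * ((r + 1 < 0) = false) *
    ((0 <= r) = true) * ((r < 0) = false) * ((r == -1) = false).
  by move=> h; do !split; apply/idP/idP; lia.
rewrite /sgn2; case: (cases s) => [/neg h|[->|/pos h]];
  case: (cases t) => [/neg h'|[->|/pos h']]; rewrite ?h ?h' /=; ring.
Qed.

Variables y z : C.
Hypotheses (yA : annulus y) (zA : annulus z).

Let y0 : y != 0 := annulus_neq0 yA.
Let z0 : z != 0 := annulus_neq0 zA.

(** The weights of the triple sum, seen as an Appell sum in [x]. *)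
Definition triple_weight (u : int * int) : C :=
  sgn2 u.1 u.2 * q ^ (u.1 * u.2) * y ^ u.1 * z ^ u.2.

Lemma triple_weight_bound u : normc (triple_weight u) <= (normc q)^-1 * (ageo y u.1 * ageo z u.2).
Proof.
case: u => s t /=; have q1' : 1 <= (normc q)^-1 by rewrite invf_ge1 // ltW.
have P : 0 <= (normc q)^-1 * (ageo y s * ageo z t).
  by rewrite !mulr_ge0 ?ageo_ge0 // invr_ge0 ltW.
have E (x : C) (m : int) : 0 <= normc x ^ m by rewrite exprz_ge0 ?normc_ge0.
rewrite /triple_weight /sgn2 /=; case: ifP => [/andP[s0 t0]|_].
  rewrite mul1r normcM [normc (_ * y ^ s)]normcM !normcXz /ageo !geo_pos //.
  rewrite mulrA; apply: ler_wpM2r => //; apply: ler_wpM2r => //.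
  apply: le_trans q1'; rewrite -(expr0z (normc q)).
  by apply: exprz_antimono nq01 _; rewrite mulr_ge0.
case: ifP => [/andP[s0 t0]|_]; last by rewrite !mul0r normc0.
rewrite mulN1r normcM [normc (_ * y ^ s)]normcM normcN !normcXz !ageo_neg //.
have -> : (normc q)^-1 * (normc q ^ (- s) * normc y ^ s * (normc q ^ (- t) * normc z ^ t))
    = normc q ^ (-1 - s - t) * (normc y ^ s * normc z ^ t).
  have pu := lt0r_neq0 nq0; rewrite (expfzDr _ _ pu) (expfzDr _ _ pu).
  by rewrite -[normc q ^ (-1)]/((normc q)^-1); ring.
rewrite -mulrA; apply: ler_wpM2r; first by rewrite mulr_ge0.
by apply: exprz_antimono nq01 _; nia.
Qed.

Lemma triple_weight_summable : abs_summable triple_weight.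
Proof.
apply: abs_summable_le triple_weight_bound (bounded_sumsZ _ (bounded_sums_prod _ _ _ _)).
- by rewrite invr_ge0 ltW.
- exact: ageo_ge0.
- exact: ageo_ge0.
- exact: ageo_bounded.
- exact: ageo_bounded.
Qed.

Lemma triple_weight_admissible : admissible q triple_weight (fun u => u.1 + u.2).
Proof.
apply: bounded_sums_le triple_weight_summable => u.
by rewrite ler_piMr ?normc_ge0 // weight_le1.
Qed.

(** The sign changes under the diagonal shift exactly on the two lines
    [s = -1] and [t = -1]; at their crossing it changes by [2]. *)
Lemma triple_weight_rec (u : int * int) : triple_weight (u.1 + 1, u.2 + 1) =
  y * z / q * (q ^ (u.1 + u.2 + 2) * triple_weight u)
  + (if u.1 == -1 then z ^ (u.2 + 1) else 0)
  + (if u.2 == -1 then y ^ (u.1 + 1) else 0).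
Proof.
case: u => s t; rewrite /triple_weight /= sgn2S.
have -> : (s + 1) * (t + 1) = s * t + (s + t + 1) by ring.
have -> : s + t + 2 = s + t + 1 + 1 by ring.
rewrite !(expfzDr _ _ q0) !(expfzDr _ _ y0) !(expfzDr _ _ z0) !expr1z.
have inv (x : C) : x ^ (-1) = x^-1 by [].
have neg (x : C) (n : int) : x ^ (- n) = (x ^ n)^-1 by rewrite invr_expz.
have qs := expfz_neq0 s q0; have qt := expfz_neq0 t q0.
have [->|s1] := eqVneq s (-1); have [->|t1] := eqVneq t (-1); rewrite /=.
- have -> : sgn2 (-1) (-1) = -1 by [].
  by rewrite mulN1r opprK !inv expr1z; field; rewrite q0 y0 z0.
- rewrite mulN1r neg !inv; move: (q ^ t) (z ^ t) (sgn2 _ _) qt => a b c a0.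
  by field; rewrite q0 y0 a0.
- rewrite mulrN1 neg !inv; move: (q ^ s) (y ^ s) (sgn2 _ _) qs => a b c a0.
  by field; rewrite q0 z0 a0.
- move: (q ^ s) (q ^ t) (q ^ (s * t)) (y ^ s) (z ^ t) (sgn2 _ _) => a b c d e g.
  by field.
Qed.

(** The sum of the weights is the Kronecker double sum. *)
Lemma triple_weight_sum : tsum triple_weight = kron y z / jtheta z q.
Proof.
have jz0 : jtheta z q != 0 := jtheta_neq0 q1 zA.
have [s e] := appell_quotient q0 q1 (kron_admissible yA) z0 jz0.
rewrite -[kron y z]/(appell q _ _ z) e mulrC mulKf // (tsum_pair triple_weight_summable).
apply: eq_tsum => n; have qn : q ^ n * z != 0 by rewrite mulf_neq0 ?expfz_neq0.
have d0 := one_sub_neq0 q0 q1 n jz0 z0.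
have pw t : q ^ (n * t) * z ^ t = (q ^ n * z) ^ t.
  by rewrite expfzMl exprz_exp.
have [n0|n0] := leP 0 n.
  rewrite -(geom_nonneg _ qn (normc_pow_lt1 zA n0)); apply: eq_tsum => t.
  rewrite /triple_weight /sgn2 /= n0 ltNge n0 /=.
  by case: ifP => _; rewrite ?mul0r // -pw; ring.
have -> : y ^ n / (1 - q ^ n * z) = - (- y ^ n / (1 - q ^ n * z)) by rewrite mulNr opprK.
rewrite -(geom_neg _ (normc_pow_gt1 zA n0)); apply: eq_tsum => t.
rewrite /triple_weight /sgn2 /= n0 leNgt n0 /=.
by case: ifP => _; rewrite ?mul0r // -pw; ring.
Qed.

(** The triple sum, multiplied by [jtheta x q]. *)
Definition tripleF (x : C) : C := appell q triple_weight (fun u => u.1 + u.2) x.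

Lemma laurent_tripleF : laurent tripleF.
Proof. exact: (eq_laurent _ (laurent_appell q0 q1 triple_weight_admissible)). Qed.

Lemma tripleF_one : tripleF 1 = qpoch q q ^+ 3.
Proof.
rewrite /tripleF appellE (@tsum_single _ _ _ (0, 0)) => [|[s t] st].
  by rewrite /triple_weight /= /sgn2 /= !expr0z !mulr1 mul1r kern0_one.
rewrite /triple_weight /sgn2 /=; have [e|st0] := eqVneq (s + t) 0; last first.
  by rewrite kern_one // mulr0.
case: ifP => [/andP[s0 t0]|_].
  have [es et] : s = 0 /\ t = 0 by lia.
  by move: st; rewrite es et eqxx.
by case: ifP => [/andP[s0 t0]|_]; [lia|rewrite !mul0r].
Qed.

(** The two lines of [triple_weight_rec] contribute the two Kronecker sums. *)
Lemma tripleF_shift x : x != 0 ->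
  tripleF x = y * z / (q * x) *
      (q * x ^+ 2 * tripleF (q ^+ 2 * x) - tsum triple_weight * jtheta x q)
    + kron z x + kron y x.
Proof.
move=> x0; have adm := triple_weight_admissible.
have [s2 e2] := appell_shift2 q0 q1 adm x0.
have s1 := appell_summable q0 q1 adm x0.
have sy := appell_summable q0 q1 (kron_admissible yA) x0.
have sz := appell_summable q0 q1 (kron_admissible zA) x0.
have c0 : q * x ^+ 2 != 0 by rewrite mulf_neq0 ?expf_neq0.
rewrite /tripleF e2 mulVKf // /tripleF appellE.
have shB : bijective (fun u : int * int => (u.1 + 1, u.2 + 1)).
  by exists (fun u => (u.1 - 1, u.2 - 1)) => -[a b] /=; congr pair; ring.
rewrite (tsum_bij shB s1) /=.
(* [B] and [D] live on the lines [s = -1] and [t = -1]. *)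
pose A (u : int * int) := y * z / (q * x) *
  (triple_weight u * kern q (u.1 + u.2 + 2) x - jtheta x q * triple_weight u).
pose B (u : int * int) := if u.1 == -1 then z ^ (u.2 + 1) * kern q (u.2 + 1) x else 0.
pose D (u : int * int) := if u.2 == -1 then y ^ (u.1 + 1) * kern q (u.1 + 1) x else 0.
have e u : triple_weight (u.1 + 1, u.2 + 1) * kern q (u.1 + 1 + (u.2 + 1)) x = A u + B u + D u.
  have -> : u.1 + 1 + (u.2 + 1) = u.1 + u.2 + 2 by ring.
  rewrite triple_weight_rec /A /B /D !mulrDl; congr (_ + _ + _).
  - have := kern_lin q0 q1 (u.1 + u.2 + 2) x0.
    move: (kern _ _ _) (jtheta _ _) (q ^ _) (triple_weight u) => k j a w h.
    have -> : w * k - j * w = w * (k - j) by ring.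
    by rewrite -h; field; rewrite x0 q0.
  - by case: eqP => [->|_]; rewrite ?mul0r //; congr (_ * kern _ _ _); ring.
  - by case: eqP => [->|_]; rewrite ?mul0r //; congr (_ * kern _ _ _); ring.
have As1 : abs_summable (fun u => triple_weight u * kern q (u.1 + u.2 + 2) x - jtheta x q * triple_weight u).
  by apply: abs_summableD s2 (abs_summableN (abs_summableZ _ triple_weight_summable)).
have As := abs_summableZ (y * z / (q * x)) As1.
have iB : injective (fun t : int => (-1 : int, t - 1)) by move=> a b [] /addIr.
have iD : injective (fun t : int => (t - 1, -1 : int)) by move=> a b [] /addIr.
have B0 u : (forall t : int, u != (-1, t - 1)) -> B u = 0.
  case: u => a b /(_ (b + 1)); rewrite addrK xpair_eqE eqxx andbT /B /=.
  by move=> /negbTE ->.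
have D0 u : (forall t : int, u != (t - 1, -1)) -> D u = 0.
  case: u => a b /(_ (a + 1)); rewrite addrK xpair_eqE eqxx /D /=.
  by move=> /negbTE ->.
have eB : (fun t : int => z ^ t * kern q t x) =1 B \o (fun t : int => (-1, t - 1)).
  by move=> t; rewrite /B /= subrK.
have eD : (fun t : int => y ^ t * kern q t x) =1 D \o (fun t : int => (t - 1, -1)).
  by move=> t; rewrite /D /= subrK.
have Bs := abs_summable_ext iB B0 (eq_abs_summable eB sz).
have Ds := abs_summable_ext iD D0 (eq_abs_summable eD sy).
have BE : tsum B = kron z x.
  rewrite -[kron z x]/(appell q _ _ x) appellE; apply: has_sum_tsum.
  exact: (proj1 (has_sum_inj _ iB B0)) (has_sum_ext eB (abs_has_sum sz)).
have DE : tsum D = kron y x.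
  rewrite -[kron y x]/(appell q _ _ x) appellE; apply: has_sum_tsum.
  exact: (proj1 (has_sum_inj _ iD D0)) (has_sum_ext eD (abs_has_sum sy)).
apply: (etrans (eq_tsum e)); apply: (etrans (tsumD (abs_summableD As Bs) Ds)).
rewrite DE; congr (_ + _); apply: (etrans (tsumD As Bs)).
rewrite BE; congr (_ + _); rewrite /A (tsumZ _ As1); congr (_ * _).
by rewrite (tsumB s2 (abs_summableZ _ triple_weight_summable)) (tsumZ _ triple_weight_summable) [jtheta _ _ * _]mulrC.
Qed.

(** The general term of the triple sum. *)
Definition triple_term (x : C) (i : int * int * int) : C :=
  q ^ (i.1.1 * i.1.2 + i.1.1 * i.2 + i.1.2 * i.2) * x ^ i.1.1 * y ^ i.1.2 * z ^ i.2.

Lemma triple_majorant x : annulus x ->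
  bounded_sums (fun i : int * int * int => ageo x i.1.1 * ageo y i.1.2 * ageo z i.2).
Proof.
move=> xA; apply: bounded_sums_prod3; try exact: ageo_ge0; exact: ageo_bounded.
Qed.

Lemma triple_nonneg_summable x : annulus x ->
  abs_summable (restr_to nonneg3 (triple_term x)).
Proof.
move=> xA; apply: abs_summable_le (triple_majorant xA) => -[[r s] t].
have P : 0 <= ageo x r * ageo y s * ageo z t by rewrite !mulr_ge0 ?ageo_ge0.
rewrite /restr_to /nonneg3 /=; case: ifP => [/and3P[r0 s0 t0]|_]; last by rewrite normc0.
rewrite /triple_term /= normcM [normc (_ * y ^ s)]normcM [normc (_ * x ^ r)]normcM.
rewrite !normcXz /ageo !geo_pos //.
have E (u : C) (m : int) : 0 <= normc u ^ m by rewrite exprz_ge0 ?normc_ge0.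
apply: ler_wpM2r => //; apply: ler_wpM2r => //; rewrite ler_piMl // -(expr0z (normc q)).
by apply: exprz_antimono nq01 _; rewrite !addr_ge0 ?mulr_ge0.
Qed.

Lemma triple_neg_summable x : annulus x ->
  abs_summable (restr_to neg3 (triple_term x)).
Proof.
move=> xA; apply: abs_summable_le (triple_majorant xA) => -[[r s] t].
have P : 0 <= ageo x r * ageo y s * ageo z t by rewrite !mulr_ge0 ?ageo_ge0.
rewrite /restr_to /neg3 /=; case: ifP => [/and3P[r0 s0 t0]|_]; last by rewrite normc0.
rewrite /triple_term /= normcM [normc (_ * y ^ s)]normcM [normc (_ * x ^ r)]normcM.
rewrite !normcXz !ageo_neg //.
have E (u : C) (m : int) : 0 <= normc u ^ m by rewrite exprz_ge0 ?normc_ge0.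
have pu := lt0r_neq0 nq0.
have -> : normc q ^ (- r) * normc x ^ r * (normc q ^ (- s) * normc y ^ s) *
    (normc q ^ (- t) * normc z ^ t) =
    normc q ^ (- r - s - t) * normc x ^ r * normc y ^ s * normc z ^ t.
  by rewrite (expfzDr _ _ pu) (expfzDr _ _ pu); ring.
do 3!(apply: ler_wpM2r => //); apply: exprz_antimono nq01 _; nia.
Qed.

(** Summing over the first index, a geometric series, turns the triple sum into
    an Appell sum. *)
Lemma triple_sum x : annulus x ->
  sum_over nonneg3 (triple_term x) + sum_over neg3 (triple_term x) =
  tripleF x / jtheta x q.
Proof.
move=> xA; have x0 := annulus_neq0 xA; have jx0 : jtheta x q != 0 := jtheta_neq0 q1 xA.
have [s e] := appell_quotient q0 q1 triple_weight_admissible x0 jx0.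
rewrite /tripleF e mulrC mulKf // !sum_overE.
have s1 := triple_nonneg_summable xA; have s2 := triple_neg_summable xA.
have s12 := abs_summableD s1 s2; rewrite -tsumD //.
pose h (u : int * int * int) := ((u.2, u.1.1), u.1.2).
have hB : bijective h by exists (fun i => ((i.1.2, i.2), i.1.1)) => -[[a b] c].
rewrite (tsum_bij hB s12) (tsum_pair (abs_summable_inj (bij_inj hB) s12)).
apply: eq_tsum => -[m n]; rewrite /h /restr_to /nonneg3 /neg3 /=.
have v0 : q ^ (m + n) * x != 0 by rewrite mulf_neq0 ?expfz_neq0.
have term r : triple_term x (r, m, n) =
    q ^ (m * n) * y ^ m * z ^ n * (q ^ (m + n) * x) ^ r.
  have -> : (q ^ (m + n) * x) ^ r = q ^ (r * m) * q ^ (r * n) * x ^ r.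
    by rewrite expfzMl exprz_exp mulrDl (expfzDr _ _ q0) ![_ * r]mulrC.
  by rewrite /triple_term /= (expfzDr _ _ q0) (expfzDr _ _ q0); ring.
rewrite /triple_weight /sgn2 /=; case: ifP => [/andP[m0 n0]|_].
  rewrite mul1r -(geom_nonneg _ v0 (normc_pow_lt1 xA (addr_ge0 m0 n0))).
  by apply: eq_tsum => r; rewrite andbT term [(m < 0)]ltNge m0 andbF addr0.
case: ifP => [/andP[m0 n0]|_].
  have -> : -1 * q ^ (m * n) * y ^ m * z ^ n / (1 - q ^ (m + n) * x) =
      - (q ^ (m * n) * y ^ m * z ^ n / (1 - q ^ (m + n) * x)) by rewrite !mulNr mul1r.
  have mn0 : m + n < 0 by lia.
  rewrite -(geom_neg _ (normc_pow_gt1 xA mn0)).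
  by apply: eq_tsum => r; rewrite andbT andbF add0r term.
rewrite !mul0r -[RHS](tsum0 R int); apply: eq_tsum => r.
by rewrite !andbF addr0.
Qed.

End Kronecker.

(** * The Appell functions of nome [q ^+ 2] *)

Section Lerch.
Variable R : realType.
Notation C := R[i].
Variable q : C.
Hypotheses (q0 : q != 0) (q1 : normc q < 1).

Local Notation q2 := (q ^+ 2).
Let q20 : q2 != 0. Proof. exact: expf_neq0. Qed.
Let q21 : normc q2 < 1. Proof. exact: normc_sqr_lt1. Qed.
Let nq0 : 0 < normc q. Proof. by rewrite normc_gt0. Qed.

Local Notation J1 := (qpoch q q).
Local Notation J2 := (qpoch q2 q2).

(** The theta function that normalises the Appell function [ell]. *)
Definition th (u : C) : C := jtheta (q * u) q2.

(** [(-1)^N q^(N^2) u^N]. *)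
Definition lerch_weight (u : C) (N : int) : C := theta_coef q2 N * (q * u) ^ N.

(** The Appell sum [sum_N (-1)^N q^(N^2) u^N / (1 + q^(2N) z)]. *)
Definition ell (u z : C) : C :=
  tsum (fun N => lerch_weight u N / (1 - q2 ^ N * - z)).

(** [jtheta (- t) q2 * ell u t], as a function of [t] without singularities. *)
Definition lam (u t : C) : C := appell q2 (lerch_weight u) id (- t).

Lemma lerch_weight_sum u : u != 0 ->
  abs_summable (lerch_weight u) /\ th u = tsum (lerch_weight u).
Proof. by move=> u0; apply: (jtheta_expands q20 q21); rewrite mulf_neq0. Qed.

Lemma lerch_admissible u : u != 0 -> admissible q2 (lerch_weight u) id.
Proof.
move=> /lerch_weight_sum[ws _]; apply: bounded_sums_le ws => N.
by rewrite ler_piMr ?normc_ge0 // weight_le1.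
Qed.

Lemma lerch_weightS u N : u != 0 ->
  lerch_weight u (N + 1) = - (u / q) * (q2 ^ (N + 1) * lerch_weight u N).
Proof.
move=> u0; rewrite /lerch_weight (theta_coefS q20) (expfzDr _ _ (mulf_neq0 q0 u0)).
by rewrite (expfzDr _ _ q20) !expr1z; field.
Qed.

Lemma lerch_weight_shift u N : lerch_weight (q2 * u) N = q2 ^ N * lerch_weight u N.
Proof. by rewrite /lerch_weight [q * (q2 * u)]mulrCA (expfzMl q2); ring. Qed.

Lemma opp_neq0 (t : C) : t != 0 -> - t != 0.
Proof. by rewrite oppr_eq0. Qed.

Lemma lam_quotient u t : u != 0 -> t != 0 -> jtheta (- t) q2 != 0 ->
  abs_summable (fun N => lerch_weight u N / (1 - q2 ^ N * - t)) /\
  lam u t = jtheta (- t) q2 * ell u t.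
Proof.
move=> u0 t0 j0.
exact: (appell_quotient q20 q21 (lerch_admissible u0) (opp_neq0 t0) j0).
Qed.

Lemma laurent_lam u : u != 0 -> laurent (lam u).
Proof.
move=> u0; exact: (laurent_opp (laurent_appell q20 q21 (lerch_admissible u0))).
Qed.

Lemma lam_shift u t : u != 0 -> t != 0 ->
  lam u (q2 * t) = q / u * lam u t + t^-1 * th u * jtheta (- t) q2.
Proof.
move=> u0 t0; have adm := lerch_admissible u0; have tN := opp_neq0 t0.
have [ws wE] := lerch_weight_sum u0.
have [s e] := appell_shift q20 q21 adm tN.
have s1 := appell_summable q20 q21 adm tN.
rewrite /lam -mulrN e (appellE _ _ _ (- t)) (tsum_bij (addz_bij 1) s1) wE.
set k1 := (fun N : int => lerch_weight u N * kern q2 (N + 1) (- t)) in s e *.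
have -> : tsum (fun N : int => lerch_weight u (N + 1) * kern q2 (N + 1) (- t)) =
    u / (q * t) * (tsum k1 - jtheta (- t) q2 * tsum (lerch_weight u)).
  rewrite -(tsumZ _ ws) -(tsumB s (abs_summableZ _ ws)) -tsumZ; last first.
    exact: abs_summableD s (abs_summableN (abs_summableZ _ ws)).
  apply: eq_tsum => N; rewrite lerch_weightS // /k1.
  have := kern_lin q20 q21 (N + 1) tN.
  move: (kern _ _ _) (jtheta _ _) (q2 ^ _) (lerch_weight u N) => k j a w h.
  have -> : w * k - j * w = w * (k - j) by ring.
  by rewrite -h; field; rewrite t0 q0.
move: (tsum _) (tsum _) (jtheta _ _) => a b j; field.
by rewrite t0 q0 u0.
Qed.

Lemma lam_one u : u != 0 -> lam u (-1) = J2 ^+ 3.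
Proof.
move=> u0; rewrite /lam opprK appellE (@tsum_single _ _ _ 0) => [|N N0].
  by rewrite /lerch_weight theta_coef0 expr0z !mul1r kern0_one.
by rewrite kern_one // mulr0.
Qed.

Lemma laurent_ell z : z != 0 -> jtheta (- z) q2 != 0 -> laurent (fun u => ell u z).
Proof.
move=> z0 j0; exists (fun N => theta_coef q2 N * q ^ N / (1 - q2 ^ N * - z)) => u u0.
have [s _] := lam_quotient u0 z0 j0.
have e N : lerch_weight u N / (1 - q2 ^ N * - z) =
    theta_coef q2 N * q ^ N / (1 - q2 ^ N * - z) * u ^ N.
  by rewrite /lerch_weight expfzMl; ring.
by split; [exact: eq_abs_summable e s|exact: eq_tsum].
Qed.

Lemma ell_shift u z : u != 0 -> z != 0 -> jtheta (- z) q2 != 0 ->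
  ell (q2 * u) z = z^-1 * (th u - ell u z).
Proof.
move=> u0 z0 j0; have [s _] := lam_quotient u0 z0 j0.
have [ws ->] := lerch_weight_sum u0.
rewrite /ell -(tsumB ws s) -tsumZ; last exact: abs_summableD ws (abs_summableN s).
apply: eq_tsum => N; rewrite lerch_weight_shift.
have := one_sub_neq0 q20 q21 N j0 (opp_neq0 z0); rewrite mulrN opprK.
by move: (lerch_weight _ _) (q2 ^ N) => w a d0; field; rewrite z0 d0.
Qed.

Lemma th_shift u : u != 0 -> th (q2 * u) = - (q * u)^-1 * th u.
Proof. by move=> u0; rewrite /th mulrCA jtheta_shift ?mulf_neq0. Qed.

Lemma jtheta_opp_shift t : t != 0 -> jtheta (- (q2 * t)) q2 = t^-1 * jtheta (- t) q2.
Proof.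
by move=> t0; rewrite -mulrN (jtheta_shift q20 q21 (opp_neq0 t0)) invrN opprK.
Qed.

Lemma laurent_th : laurent th.
Proof. exact: (laurent_jthetaM q20 q21 q0). Qed.

Lemma annulus_sqr (z : C) : annulus q z -> normc q2 < normc z < 1.
Proof.
move=> /andP[qz ->]; rewrite andbT; apply: lt_trans qz.
by rewrite normcX expr2 gtr_pMr.
Qed.

Lemma jtheta_opp_neq0 z : annulus q z -> jtheta (- z) q2 != 0.
Proof. by move=> /annulus_sqr zA; apply: jtheta_neq0 => //; rewrite normcN. Qed.

Lemma th_neq0 z : annulus q z -> th z != 0.
Proof.
move=> /andP[qz z1]; apply: jtheta_neq0 => //; rewrite normcX normcM expr2.
by rewrite ltr_pM2l // qz /= mulr_ilt1 ?normc_ge0.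
Qed.

(** Divided by [jtheta (- y) q2], this relates [ell y z] to [ell z y].  As a
    function of [y], the difference of the two sides is a theta function of
    degree one that vanishes at [-1]. *)
Lemma ell_symmetric_relation y z : y != 0 -> annulus q z ->
  jtheta (- y) q2 * (th z * ell y z - th y * th z) + th y * lam z y =
  th (-1) * J2 ^+ 3 * jtheta (z * y) q2 / jtheta (- z) q2.
Proof.
move=> y0 zA; have z0 := annulus_neq0 q0 zA; have j0 := jtheta_opp_neq0 zA.
pose Rf y := jtheta (- y) q2 * (th z * ell y z - th z * th y) + th y * lam z y
  - th (-1) * J2 ^+ 3 / jtheta (- z) q2 * jtheta (z * y) q2.
have lj := laurent_jtheta q20 q21.
have lR : laurent Rf.
  apply: laurentB (laurentD (laurentM (laurent_opp lj) (laurentB _ _))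
    (laurentM laurent_th (laurent_lam z0))) _.
  - exact: laurentZ (laurent_ell z0 j0).
  - exact: laurentZ laurent_th.
  - exact: laurentZ (laurent_jthetaM q20 q21 z0).
have [t t0|k hk] := degree1 q20 q21 z0 lR.
  rewrite /Rf jtheta_opp_shift // ell_shift // th_shift // lam_shift //.
  rewrite [z * (q2 * t)]mulrCA (jtheta_shift q20 q21) ?mulf_neq0 //.
  move: (jtheta _ _) (jtheta _ _) (jtheta _ _) j0 (ell _ _) (lam _ _) => a b c c0 e f.
  by move: (th _) (th _) (th _) (J2 ^+ 3) => g h i l; field; rewrite ?t0 ?q0 ?z0 ?c0.
have k0 : k = 0.
  have N1 : (-1 : C) != 0 := opp_neq0 (oner_neq0 _).
  have := hk _ N1; rewrite /Rf lam_one // opprK (jtheta_one q21) mul0r add0r mulrN1.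
  rewrite divfK // subrr.
  by move/esym/eqP; rewrite mulf_eq0 (negbTE j0) orbF => /eqP.
have := hk _ y0; rewrite k0 mul0r /Rf => /eqP; rewrite subr_eq0 => /eqP h.
move: h; move: (jtheta _ _) (th _) (th _) (ell _ _) (lam _ _) => a b c d f h.
by rewrite [X in _ = X]mulrAC -h; ring.
Qed.

End Lerch.

(** * The identity *)

(* The three computations below are pure algebra; every variable stands for
   the value of a theta function or of an Appell function. *)

Lemma shift_algebra (F : fieldType)
    (q x y z t t' A B B' D f j jm l py pz ly lz ty tz ky kz u : F) :
  q != 0 -> x != 0 -> y != 0 -> z != 0 ->
  t = y * z / (q * x) * (q * x ^+ 2 * t' - f * j) + kz + ky ->
  f = A * u -> ky = B * (py * ty) -> kz = B' * (pz * tz) ->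
  x^-1 * jm * t' - A * ((q * x ^+ 2)^-1 * j) * (q / (y * z) * l + x^-1 * u * jm)
  - x^-1 * jm * (B * (- (y * x)^-1 * py) * (z^-1 * (ty - ly))
                 + B' * (- (z * x)^-1 * pz) * (y^-1 * (tz - lz)))
  + D * (- (y * x)^-1 * py) * (- (z * x)^-1 * pz) =
  (y * z * x ^+ 2)^-1 *
  (jm * t - A * j * l - jm * (B * py * ly + B' * pz * lz) + D * py * pz).
Proof.
move=> q0 x0 y0 z0 -> -> -> ->; field.
by rewrite q0 x0 y0 z0.
Qed.

Lemma one_algebra (F : fieldType)
    (K J c jm phi ty tz Y Z Ym Zm W lyz lzy : F) :
  c != 0 -> ty != 0 -> tz != 0 -> Y != 0 -> Z != 0 -> Ym != 0 -> Zm != 0 ->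
  ty * tz + phi * J * W / (Ym * Zm) = tz * lyz + ty * lzy ->
  c * (jm * phi) = 2 / c ->
  jm * K - jm * (K * c / (c * (Y * ty)) * Y * lyz + K * c / (c * (Z * tz)) * Z * lzy)
  + 2 * K * J * W / (c * (Y * ty) * (c * (Z * tz)) * (Ym * Zm)) * Y * Z = 0.
Proof.
move=> c0 ty0 tz0 Y0 Z0 Ym0 Zm0 h1 h2.
have -> : jm * K - jm * (K * c / (c * (Y * ty)) * Y * lyz + K * c / (c * (Z * tz)) * Z * lzy)
    + 2 * K * J * W / (c * (Y * ty) * (c * (Z * tz)) * (Ym * Zm)) * Y * Z =
    K / (ty * tz) * (jm * (ty * tz - (tz * lyz + ty * lzy))
      + 2 / c / c * (J * W / (Ym * Zm))).
  by field; rewrite c0 ty0 tz0 Y0 Z0 Ym0 Zm0.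
rewrite -h1 -h2 [c * _]mulrC mulfK //; field.
by rewrite ty0 tz0 Ym0 Zm0.
Qed.

Lemma final_algebra (F : fieldType)
    (A B B' D S K J2 c X Y Z Xm Ym Zm Wxy Wxz Wyz txy txz tyz lx ly lz : F) :
  X != 0 -> Y != 0 -> Z != 0 -> Xm != 0 -> Ym != 0 -> Zm != 0 ->
  txy != 0 -> txz != 0 -> tyz != 0 ->
  A = K * c * Wyz / (Y * Z) -> B = K * c / Y -> B' = K * c / Z ->
  D = 2 * K * J2 * Wyz / (Y * Z * (Ym * Zm)) ->
  Xm * S - A * X * (Xm * lx) - Xm * (B * Wxy * lz + B' * Wxz * ly) + D * Wxy * Wxz = 0 ->
  S / X = K * (c * (Wyz * tyz)) / (Y * Z) * (tyz^-1 * lx)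
    + K * (c * (Wxy * txy)) / (X * Y) * (txy^-1 * lz)
    - 2 * (K * J2 / (X * Y * Z)) * (Wxy * Wxz * Wyz / (Xm * Ym * Zm))
    + K * (c * (Wxz * txz)) / (X * Z) * (txz^-1 * ly).
Proof.
move=> X0 Y0 Z0 Xm0 Ym0 Zm0 txy0 txz0 tyz0 -> -> -> -> h.
have -> : S = (K * c * Wyz / (Y * Z) * X * (Xm * lx)
    + Xm * (K * c / Y * Wxy * lz + K * c / Z * Wxz * ly)
    - 2 * K * J2 * Wyz / (Y * Z * (Ym * Zm)) * Wxy * Wxz) / Xm.
  apply: (mulfI Xm0); rewrite [RHS]mulrC divfK //.
  by apply/eqP; rewrite -subr_eq0 -h; apply/eqP; ring.
by field; rewrite X0 Y0 Z0 Xm0 Ym0 Zm0 txy0 txz0 tyz0.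
Qed.

Section Identity.
Variable R : realType.
Notation C := R[i].
Variable q : C.
Hypotheses (q0 : q != 0) (q1 : normc q < 1).

Local Notation q2 := (q ^+ 2).
Let q20 : q2 != 0. Proof. exact: expf_neq0. Qed.
Let q21 : normc q2 < 1. Proof. exact: normc_sqr_lt1. Qed.
Let nq0 : 0 < normc q. Proof. by rewrite normc_gt0. Qed.

Local Notation J1 := (qpoch q q).
Local Notation J2 := (qpoch q2 q2).

(** The constant of the factorisation [jtheta_split]. *)
Definition split_cst : C := J1 / J2 ^+ 2.

Lemma J1_neq0 : J1 != 0. Proof. exact: qpoch_neq0_lt1. Qed.
Lemma J2_neq0 : J2 != 0. Proof. exact: qpoch_neq0_lt1. Qed.

Lemma split_cst_neq0 : split_cst != 0.
Proof. by rewrite mulf_neq0 ?invr_neq0 ?expf_neq0 ?J1_neq0 ?J2_neq0. Qed.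

Lemma jthetaE (u p : C) : jtheta u p = qpoch u p * qpoch (p / u) p * qpoch p p.
Proof. by []. Qed.

Lemma jtheta_split u : u != 0 -> jtheta u q = split_cst * (jtheta u q2 * th q u).
Proof.
move=> u0; rewrite /th !jthetaE (qpoch_split u q1) (qpoch_split (q / u) q1) /split_cst.
have -> : q * (q / u) = q2 / u by rewrite mulrA -expr2.
have -> : q2 / (q * u) = q / u by field; rewrite q0 u0.
move: J2_neq0; move: (qpoch _ _) (qpoch _ _) (qpoch _ _) (qpoch _ _) J1 J2.
by move=> a b c d e f f0; field.
Qed.

Lemma jtheta_N1 : jtheta (-1) q = 2 / split_cst.
Proof.
rewrite /split_cst jthetaE (qpoch_rec (-1) q1) invrN1 !mulrN1 -(qpoch_opp q1).
have := J2_neq0; rewrite -(qpoch_opp q1) mulf_eq0 negb_or => /andP[].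
by move: (qpoch _ _) J1 => a b a0 b0; field; rewrite a0 b0.
Qed.

Variables y z : C.
Hypotheses (yA : annulus q y) (zA : annulus q z).

Let y0 : y != 0 := annulus_neq0 q0 yA.
Let z0 : z != 0 := annulus_neq0 q0 zA.

(** The factors, independent of [x], of the four terms of [defect]. *)
Definition coefA : C :=
  J1 ^+ 3 * split_cst * jtheta (y * z) q2 / (jtheta y q * jtheta z q).
Definition coefB : C := J1 ^+ 3 * split_cst / jtheta y q.
Definition coefB' : C := J1 ^+ 3 * split_cst / jtheta z q.
Definition coefD : C :=
  2 * J1 ^+ 3 * J2 ^+ 3 * jtheta (y * z) q2
  / (jtheta y q * jtheta z q * (jtheta (- y) q2 * jtheta (- z) q2)).

(** The difference of the two sides of the identity, multiplied by
    [jtheta x q * jtheta (- x) q2]. *)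
Definition defect (x : C) : C :=
  jtheta (- x) q2 * tripleF q y z x - coefA * jtheta x q * lam q (y * z) x
  - jtheta (- x) q2 * (coefB * jtheta (y * x) q2 * ell q (y * x) z
                       + coefB' * jtheta (z * x) q2 * ell q (z * x) y)
  + coefD * jtheta (y * x) q2 * jtheta (z * x) q2.

Let jy0 : jtheta y q != 0 := jtheta_neq0 q1 yA.
Let jz0 : jtheta z q != 0 := jtheta_neq0 q1 zA.

Lemma laurent_defect : laurent defect.
Proof.
have lj := laurent_jtheta q20 q21; have lN := laurent_opp lj.
have ly := laurent_jthetaM q20 q21 y0; have lz := laurent_jthetaM q20 q21 z0.
apply: laurentD; [apply: laurentB; [apply: laurentB|]|].
- exact: (laurentM lN (laurent_tripleF q0 q1 yA zA)).
- by apply: laurentM (laurent_lam q0 q1 (mulf_neq0 y0 z0)); apply/laurentZ/laurent_jtheta.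
- apply: (laurentM lN); apply: laurentD; apply: laurentM.
  + exact: laurentZ.
  + exact: (laurent_dilate y0 (laurent_ell q0 q1 z0 (jtheta_opp_neq0 q0 q1 zA))).
  + exact: laurentZ.
  + exact: (laurent_dilate z0 (laurent_ell q0 q1 y0 (jtheta_opp_neq0 q0 q1 yA))).
- by apply: laurentM lz; apply: laurentZ.
Qed.

(** The terms that do not fit the functional equation cancel in pairs, once the
    Kronecker sums are written as quotients of theta functions. *)
Lemma defect_shift x : x != 0 -> defect (q2 * x) = (y * z * x ^+ 2)^-1 * defect x.
Proof.
move=> x0; have yx0 := mulf_neq0 y0 x0; have zx0 := mulf_neq0 z0 x0.
have jyN := jtheta_opp_neq0 q0 q1 yA; have jzN := jtheta_opp_neq0 q0 q1 zA.
have js : jtheta (q2 * x) q = (q * x ^+ 2)^-1 * jtheta x q.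
  rewrite expr2 -mulrA (jtheta_shift q0 q1 (mulf_neq0 q0 x0)) (jtheta_shift q0 q1 x0).
  by move: (jtheta _ _) => a; field; rewrite x0 q0.
rewrite /defect (jtheta_opp_shift q0 q1 x0) js (lam_shift q0 q1 (mulf_neq0 y0 z0) x0).
rewrite [y * (q2 * x)]mulrCA [z * (q2 * x)]mulrCA.
rewrite (jtheta_shift q20 q21 yx0) (jtheta_shift q20 q21 zx0).
rewrite (ell_shift q0 q1 yx0 z0 jzN) (ell_shift q0 q1 zx0 y0 jyN).
refine (@shift_algebra _ q x y z _ _ coefA coefB coefB' coefD _ _
  (jtheta (- x) q2) (lam q (y * z) x) (jtheta (y * x) q2) (jtheta (z * x) q2)
  (ell q (y * x) z) (ell q (z * x) y) (th q (y * x)) (th q (z * x)) _ _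
  (th q (y * z)) q0 x0 y0 z0 (tripleF_shift q0 q1 yA zA x0) _ _ _).
- rewrite (triple_weight_sum q0 q1 yA zA) (kron_jtheta q0 q1 yA z0) (jtheta_split (mulf_neq0 y0 z0)).
  rewrite /coefA; move: jy0 jz0; move: (jtheta _ _) (jtheta _ _) (jtheta _ _) (th _ _).
  by move=> a b c d a0 b0; field; rewrite a0 b0.
- rewrite (kron_jtheta q0 q1 yA x0) (jtheta_split yx0) /coefB; move: jy0.
  by move: (jtheta _ _) (jtheta _ _) (th _ _) => a b c a0; field.
- rewrite (kron_jtheta q0 q1 zA x0) (jtheta_split zx0) /coefB'; move: jz0.
  by move: (jtheta _ _) (jtheta _ _) (th _ _) => a b c a0; field.
Qed.

Lemma defect_one : defect 1 = 0.
Proof.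
have N1 : (-1 : C) != 0 by rewrite oppr_eq0 oner_neq0.
rewrite /defect (tripleF_one q0 q1 yA zA) (jtheta_one q1) !mulr1 mulr0 mul0r subr0.
rewrite /coefB /coefB' /coefD (jtheta_split y0) (jtheta_split z0).
have j2y : jtheta y q2 != 0 := jtheta_neq0 q21 (annulus_sqr q0 q1 yA).
have j2z : jtheta z q2 != 0 := jtheta_neq0 q21 (annulus_sqr q0 q1 zA).
have Ym := jtheta_opp_neq0 q0 q1 yA; have Zm := jtheta_opp_neq0 q0 q1 zA.
refine (@one_algebra _ (J1 ^+ 3) (J2 ^+ 3) split_cst (jtheta (-1) q2) (th q (-1)) (th q y)
  (th q z) (jtheta y q2) (jtheta z q2) (jtheta (- y) q2) (jtheta (- z) q2)
  (jtheta (y * z) q2) (ell q y z) (ell q z y) split_cst_neq0 (th_neq0 q0 q1 yA)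
  (th_neq0 q0 q1 zA) j2y j2z Ym Zm _ _).
- have := ell_symmetric_relation q0 q1 y0 zA.
  have [_ ->] := lam_quotient q0 q1 z0 y0 Ym; rewrite [z * y]mulrC => E.
  rewrite invfM [(jtheta (- y) q2)^-1 * _]mulrC [_ * (_ / _)]mulrA -E.
  move: (jtheta _ _) Ym (th _ _) (th _ _) (ell _ _ _) (ell _ _ _) => a a0 b c d e.
  by field.
- by rewrite -(jtheta_split N1) jtheta_N1.
Qed.

Lemma defect_N1 : defect (-1) = 0.
Proof.
rewrite /defect !mulrN1 opprK (jtheta_one q21) !mul0r sub0r subr0.
rewrite jtheta_N1 (lam_one q0 q1 (mulf_neq0 y0 z0)) /coefA /coefD.
have Ym := jtheta_opp_neq0 q0 q1 yA; have Zm := jtheta_opp_neq0 q0 q1 zA.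
move: jy0 jz0 Ym Zm split_cst_neq0.
move: (jtheta _ _) (jtheta _ _) (jtheta _ _) (jtheta _ _) (jtheta _ _) split_cst (J2 ^+ 3) (J1 ^+ 3).
move=> a b c d e k j1 j2 a0 b0 c0 d0 k0; field.
by rewrite a0 b0 c0 d0 k0.
Qed.

Lemma annulusM (u v : C) : annulus q u -> annulus q v ->
  normc q ^+ 2 < normc (u * v) < 1.
Proof.
move=> /andP[u1 u2] /andP[v1 v2]; rewrite normcM expr2 ltr_pM ?normc_ge0 //=.
by rewrite mulr_ilt1 ?normc_ge0.
Qed.

Lemma defect_eq0 x : x != 0 -> defect x = 0.
Proof.
exact: (degree2_eq0 q0 q1 (annulusM yA zA) laurent_defect defect_shift
  defect_one defect_N1).
Qed.

End Identity.

Lemma annulusE (R : realType) (q x : R[i]) : `|q| < `|x| < 1 -> annulus q x.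
Proof.
rewrite !normcE -[1]/((1 : R)%:C) !ltcR; exact.
Qed.

Section Conclusion.
Variable R : realType.
Notation C := R[i].
Variable q : C.
Hypotheses (q0 : q != 0) (q1 : normc q < 1).

Local Notation q2 := (q ^+ 2).

Lemma thM_neq0 (u v : C) : annulus q u -> annulus q v -> u * v != q ->
  th q (u * v) != 0.
Proof.
move=> uA vA uvq; have q21 := normc_sqr_lt1 q1.
have nq0 : 0 < normc q by rewrite normc_gt0.
have [u0 v0] := (annulus_neq0 q0 uA, annulus_neq0 q0 vA).
have /andP[w1 w2] := annulusM uA vA; have w0 := mulf_neq0 u0 v0.
have nw : 0 < normc (u * v) by rewrite normc_gt0.
have e : q2 / (q * (u * v)) = q / (u * v) by field; rewrite ?q0 ?u0 ?v0.
rewrite /th jthetaE e; apply: mulf_neq0; last exact: qpoch_neq0_lt1.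
apply: mulf_neq0; first by rewrite qpoch_neq0_lt1 // normcM mulr_ilt1 ?normc_ge0.
apply: qpoch_neq0_head => //.
  by apply: contraNneq uvq => h; rewrite -[q](divfK w0) h mul1r.
rewrite mulrA normcM normcV ltr_pdivrMr // mul1r [normc (q2 * q)]normcM normcX.
apply: lt_trans w1.
by rewrite gtr_pMr ?exprn_gt0.
Qed.

Lemma appell_lerchE (x u v : C) : u != 0 -> v != 0 ->
  appell_lerch (- (q * x / (u * v))) q2 (q * u * v) =
  (th q (u * v))^-1 * ell q (u * v) x.
Proof.
move=> u0 v0; rewrite /appell_lerch -[q * u * v]mulrA; congr (_ * _).
apply: eq_tsum => r; congr (_ / (1 - _)).
rewrite (expfzDr _ _ (expf_neq0 2 q0)) -[q2 ^ (-1)]/(q2^-1).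
by move: (q2 ^ r) => a; field; rewrite ?q0 ?u0 ?v0.
Qed.

Lemma triple_sum_identity (x y z : C) :
  annulus q x -> annulus q y -> annulus q z ->
  y * z != q -> x * y != q -> x * z != q ->
  sum_over nonneg3 (triple_term q y z x) + sum_over neg3 (triple_term q y z x) =
  (qpoch q q ^+ 3 * jtheta (y * z) q) / (jtheta y q * jtheta z q)
    * appell_lerch (- (q * x / (y * z))) q2 (q * y * z)
  + (qpoch q q ^+ 3 * jtheta (x * y) q) / (jtheta x q * jtheta y q)
    * appell_lerch (- (q * z / (x * y))) q2 (q * x * y)
  - 2 * ((qpoch q q ^+ 3 * qpoch q2 q2 ^+ 3)
         / (jtheta x q * jtheta y q * jtheta z q))
    * ((jtheta (x * y) q2 * jtheta (x * z) q2 * jtheta (y * z) q2)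
       / (jtheta (- x) q2 * jtheta (- y) q2 * jtheta (- z) q2))
  + (qpoch q q ^+ 3 * jtheta (x * z) q) / (jtheta x q * jtheta z q)
    * appell_lerch (- (q * y / (x * z))) q2 (q * x * z).
Proof.
move=> xA yA zA yzq xyq xzq.
have [[x0 y0] z0] := (annulus_neq0 q0 xA, annulus_neq0 q0 yA, annulus_neq0 q0 zA).
have jx0 : jtheta x q != 0 := jtheta_neq0 q1 xA.
have jy0 : jtheta y q != 0 := jtheta_neq0 q1 yA.
have jz0 : jtheta z q != 0 := jtheta_neq0 q1 zA.
have jxN := jtheta_opp_neq0 q0 q1 xA.
have jyN := jtheta_opp_neq0 q0 q1 yA.
have jzN := jtheta_opp_neq0 q0 q1 zA.
rewrite (triple_sum q0 q1 yA zA xA) !appell_lerchE //.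
rewrite (jtheta_split q0 q1 (mulf_neq0 y0 z0)) (jtheta_split q0 q1 (mulf_neq0 x0 y0)).
rewrite (jtheta_split q0 q1 (mulf_neq0 x0 z0)).
have := defect_eq0 q0 q1 yA zA x0.
rewrite /defect; have [_ ->] := lam_quotient q0 q1 (mulf_neq0 y0 z0) x0 jxN.
rewrite [y * x]mulrC [z * x]mulrC => h.
exact: (@final_algebra _ (coefA q y z) (coefB q y) (coefB' q z) (coefD q y z)
  (tripleF q y z x) (qpoch q q ^+ 3) (qpoch q2 q2 ^+ 3) (split_cst q)
  (jtheta x q) (jtheta y q) (jtheta z q)
  (jtheta (- x) q2) (jtheta (- y) q2) (jtheta (- z) q2)
  (jtheta (x * y) q2) (jtheta (x * z) q2) (jtheta (y * z) q2)
  (th q (x * y)) (th q (x * z)) (th q (y * z))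
  (ell q (y * z) x) (ell q (x * z) y) (ell q (x * y) z)
  jx0 jy0 jz0 jxN jyN jzN (thM_neq0 xA yA xyq) (thM_neq0 xA zA xzq)
  (thM_neq0 yA zA yzq) erefl erefl erefl erefl h).
Qed.

End Conclusion.

(* Given the annuli, y z, x y, x z <> q says exactly that the three values of
   appell_lerch on the right-hand side are defined. *)
Theorem corollary1p2 (R : realType) (q x y z : R[i])
    (q_gt0 : 0 < `|q|) (q_lt1 : `|q| < 1)
    (x_neq0 : x != 0) (y_neq0 : y != 0) (z_neq0 : z != 0)
    (x_annulus : `|q| < `|x| < 1)
    (y_annulus : `|q| < `|y| < 1)
    (z_annulus : `|q| < `|z| < 1)
    (yz_generic : y * z != q) (xy_generic : x * y != q)
    (xz_generic : x * z != q) :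
  let a (i : int * int * int) : R[i] :=
    let r := i.1.1 in let s := i.1.2 in let t := i.2 in
    q ^ (r * s + r * t + s * t) * x ^ r * y ^ s * z ^ t in
  let j (u p : R[i]) : R[i] := jtheta u p in
  let J (m : nat) : R[i] := Jprod q m in
  let m (u p v : R[i]) : R[i] := appell_lerch u p v in
  [/\ summable_over nonneg3 a, summable_over neg3 a &
    sum_over nonneg3 a + sum_over neg3 a
    = (J 1%N ^+ 3 * j (y * z) q) / (j y q * j z q)
        * m (- (q * x / (y * z))) (q ^+ 2) (q * y * z)
    + (J 1%N ^+ 3 * j (x * y) q) / (j x q * j y q)
        * m (- (q * z / (x * y))) (q ^+ 2) (q * x * y)
    - 2 * ((J 1%N ^+ 3 * J 2%N ^+ 3) / (j x q * j y q * j z q))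
        * ((j (x * y) (q ^+ 2) * j (x * z) (q ^+ 2) * j (y * z) (q ^+ 2))
           / (j (- x) (q ^+ 2) * j (- y) (q ^+ 2) * j (- z) (q ^+ 2)))
    + (J 1%N ^+ 3 * j (x * z) q) / (j x q * j z q)
        * m (- (q * y / (x * z))) (q ^+ 2) (q * x * z)].
Proof.
move=> a j J m; have q0 : q != 0 by rewrite -normr_gt0.
have q1 : normc q < 1 by move: q_lt1; rewrite normcE -[1]/((1 : R)%:C) ltcR.
have xA := annulusE x_annulus; have yA := annulusE y_annulus.
have zA := annulusE z_annulus; split.
- exact/abs_summable_cvg/(triple_nonneg_summable q0 q1 yA zA xA).
- exact/abs_summable_cvg/(triple_neg_summable q0 q1 yA zA xA).
- rewrite /J (JprodE q1 (ltn0Sn 0)) (JprodE q1 (ltn0Sn 1)) expr1.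
  exact: triple_sum_identity.
Qed.
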